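(* Let $\mu$ be an arbitrary infinite cardinal. Then there are cardinals $\lambda_0,\ldots,\lambda_4$ such that $\lambda_0\leq\mu$, $\lambda_{i+1}\leq\operatorname{ded}(\lambda_i)$ for every $i<4$, and $2^{\mu}\leq\lambda_4$. In particular $2^{\mu}\leq\operatorname{ded}(\operatorname{ded}(\operatorname{ded}(\operatorname{ded}\mu)))$.
   Context: For an infinite cardinal $\kappa$, $\operatorname{ded}\kappa=\sup\{|I|: I \text{ is a linear order with a dense subset of size }\leq\kappa\}$. *)

(* Defs.v *)
From HB Require Import structures.
From mathcomp Require Import all_boot all_order all_classical.

Set Implicit Arguments.
Unset Strict Implicit.
Unset Printing Implicit Defensive.

Import Order.TTheory.

Local Open Scope classical_set_scope.
Local Open Scope card_scope.

(* A cardinal is represented by any type of that cardinality, and cardinals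
   are compared by the existence of an injection, [card_le] on full sets.
   [cardinal] fixes one universe, so that 2^mu and ded mu are again
   cardinals whenever mu is. *)
Definition cardinal := Type.

Definition le_cardinal (K L : cardinal) : Prop := [set: K] #<= [set: L].

Definition infinite_cardinal (K : cardinal) : Prop := infinite_set [set: K].

(* 2^K as the set of functions from K to a two-element set. *)
Definition pow2 (K : cardinal) : cardinal := K -> bool.

Definition dense_subset d (I : orderType d) (A : set I) : Prop :=
  forall x y : I, (x < y)%O -> exists2 a, A a & (x < a < y)%O.

(* |I| is one of the cardinals whose supremum is ded K. *)
Definition ded_order (K : cardinal) d (I : orderType d) : Prop :=
  exists2 A : set I, dense_subset A & A #<= [set: K].

Definition ded_bound (K B : cardinal) : Prop :=
  forall d (I : orderType d), ded_order K I -> [set: I] #<= [set: B].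

Definition is_ded (K D : cardinal) : Prop :=
  ded_bound K D /\ forall B : cardinal, ded_bound K B -> le_cardinal D B.

Lemma inj_card_leT (T U : Type) (f : T -> U) :
  injective f -> [set: T] #<= [set: U].
Proof.
move=> fI; have [g] : $|{injfun [set: T] >-> [set: U]}|.
  by apply/injfunPex; exists f => // x y _ _; exact: fI.
exact: inj_card_le g.
Qed.

Lemma card_le_min (T : Type) (F : set (set T)) : F !=set0 ->
  exists2 A, F A & forall B, F B -> A #<= B.
Proof.
move=> [A0 FA0].
pose P (X : set (set T -> T)) :=
  (forall f, X f -> forall B, F B -> B (f B)) /\
  (forall f g B, X f -> X g -> F B -> f B = g B -> f = g).
have [G GP Gtot|X [[Xin Xinj] Xmax]] := @Zorn_bigcup _ P.
  split=> [f [X GX Xf]|f g B [X GX Xf] [Y GY Yg]].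
    exact: (GP _ GX).1.
  have [XY|YX] := Gtot _ _ GX GY.
    by apply: (GP _ GY).2 => //; exact: XY.
  by apply: (GP _ GX).2 => //; exact: YX.
have [A FA Asurj] : exists2 A, F A & forall a, A a -> exists2 f, X f & f A = a.
  apply: contrapT => noA.
  have miss B : F B -> exists2 b, B b & forall f, X f -> f B <> b.
    move=> FB; apply: contrapT => nob; apply: noA; exists B => // b Bb.
    by apply: contrapT => nof; apply: nob; exists b => // f Xf fb; apply: nof; exists f.
  have [g gP] : {g : set T -> T & forall B, F B ->
      B (g B) /\ forall f, X f -> f B <> g B}.
    apply: (boolp.choice (P := fun B b => F B -> B b /\ forall f, X f -> f B <> b)).
    move=> B; have [FB|nFB] := pselect (F B).
      by have [b Bb bP] := miss _ FB; exists b.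
    by have [b _ _] := miss _ FA0; exists b.
  apply: (Xmax (X `|` [set g])).
    split=> [f Xf|sub]; first by left.
    by have /(gP _ FA0).2 := sub g (or_intror erefl).
  split=> [f [Xf|->] B FB|f h B [Xf|->] [Xh|->] FB] //.
  - exact: Xin Xf _ FB.
  - exact: (gP _ FB).1.
  - exact: Xinj.
  - by move=> /((gP _ FB).2 _ Xf).
  - by move=> /esym /((gP _ FB).2 _ Xh).
exists A => // B FB.
have [h hP] : {h : T -> T & forall a, A a ->
    exists f, [/\ X f, f A = a & f B = h a]}.
  apply: (boolp.choice
    (P := fun a b => A a -> exists f, [/\ X f, f A = a & f B = b])) => a; have [Aa|nAa] := pselect (A a); last by exists a.
  by have [f Xf fA] := Asurj _ Aa; exists (f B) => _; exists f.
have [g] : $|{injfun A >-> B}|.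
  apply/injfunPex; exists h => [a Aa|a b].
    by have [f [Xf _ <-]] := hP _ Aa; exact: Xin Xf _ FB.
  rewrite !inE => Aa Ab hab.
  have [f [Xf fA fB]] := hP _ Aa; have [k [Xk kA kB]] := hP _ Ab.
  by rewrite -fA -kA; congr (_ A); apply: (Xinj _ _ B) => //; rewrite fB kB.
exact: inj_card_le g.
Qed.

Lemma card_le_total (T U : Type) :
  [set: T] #<= [set: U] \/ [set: U] #<= [set: T].
Proof.
pose A : set (T + U) := range inl; pose B : set (T + U) := range inr.
have TA : [set: T] #= A by rewrite card_eq_sym inj_card_eq// => ? ? _ _ [].
have UB : [set: U] #= B by rewrite card_eq_sym inj_card_eq// => ? ? _ _ [].
have [|C [->|->] Cmin] := @card_le_min _ [set A; B]; first by exists A; left.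
  by left; rewrite (card_le_eql TA) (card_le_eqr UB); apply: Cmin; right.
by right; rewrite (card_le_eql UB) (card_le_eqr TA); apply: Cmin; left.
Qed.

Lemma ded_order_le (K : cardinal) d (I : orderType d) :
  ded_order K I -> [set: I] #<= [set: set K].
Proof.
case=> A Adense /card_leP[f].
pose cut (x : I) : set K := [set val (f a) | a in [set a : A | (val a < x)%O]].
apply: (@inj_card_leT _ _ cut).
suff cut_neq x y : (x < y)%O -> cut x <> cut y.
  by move=> x y cxy; case: (ltgtP x y) => // /cut_neq; rewrite cxy.
move=> /Adense[a Aa /andP[xa ay]] cxy.
have : cut x (val (f (SigSub (mem_set Aa)))) by rewrite cxy; exists (SigSub (mem_set Aa)).
case=> b /= bx /val_inj.
have /(_ b (SigSub (mem_set Aa))) := 'inj_f.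
rewrite !inE => /(_ Logic.I Logic.I)/[apply] bE.
by move: bx; rewrite bE /= ltNge (ltW xa).
Qed.

Lemma ded_exists (K : cardinal) : exists D : cardinal, is_ded K D.
Proof.
pose F := [set A : set (set K) | forall d (I : orderType d),
  ded_order K I -> [set: I] #<= A].
have [|A FA Amin] := @card_le_min _ F.
  by exists setT => d I; exact: ded_order_le.
have AE : [set: A] #= A by exact: card_setT.
exists A; split=> [d I /FA|B BP]; first by rewrite (card_le_eqr AE).
rewrite /le_cardinal (card_le_eql AE).
have [WB|BW] := card_le_total (set K) B.
  by apply: card_le_trans WB; apply: subset_card_le.
have /pcard_injP[f fI] := BW.
have fE : [set f x | x in [set: B]] #= [set: B] by rewrite inj_card_eq.
rewrite -(card_le_eqr fE); apply: Amin => d I /BP.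
by rewrite (card_le_eqr fE).
Qed.

Definition ded (K : cardinal) : cardinal := projT1 (cid (ded_exists K)).

Lemma dedP (K : cardinal) : is_ded K (ded K).
Proof. exact: projT2 (cid (ded_exists K)). Qed.

(* Any linear order relation on a cardinal contributes to the supremum: asking
   for an [orderType] structure loses nothing. *)
Lemma ded_ub_rel (K I : cardinal) (le : I -> I -> Prop) (A : set I) :
  (forall x y, le x y -> le y x -> x = y) ->
  (forall x y z, le x y -> le y z -> le x z) ->
  (forall x y, le x y \/ le y x) ->
  (forall x y, ~ le y x -> exists2 a, A a & ~ le a x /\ ~ le y a) ->
  A #<= [set: K] -> le_cardinal I (ded K).
Proof.
move=> anti trans tot dense AK.
pose leb x y := `[< le x y >]; pose ltb x y := ~~ leb y x.
have lebb_def x y : ltb x y = (y != x :> {classic I}) && leb x y.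
  rewrite /ltb /leb; apply/idP/andP => [/asboolPn yx|[/eqP yx /asboolP xy]].
    split; last by have [?|/yx] := tot x y; first exact/asboolP.
    by apply/eqP => xy; apply: yx; rewrite xy; have [] := tot x x.
  by apply/asboolPn => /anti/(_ xy).
have anti_leb : antisymmetric leb.
  by move=> x y /andP[/asboolP xy /asboolP]; exact: anti.
have trans_leb : transitive leb.
  by move=> y x z /asboolP xy /asboolP yz; apply/asboolP; exact: trans yz.
have tot_leb : total leb.
  by move=> x y; apply/orP; have [xy|yx] := tot x y; [left|right]; apply/asboolP.
pose ordI := Order.isOrder.Build Order.default_display {classic I}
  lebb_def (fun _ _ => erefl) (fun _ _ => erefl) anti_leb trans_leb tot_leb.
pose J : orderType _ := HB.pack {classic I} ordI.
apply: ((dedP K).1 _ J); exists A => // x y /asboolPn/dense[a Aa [xa ay]].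
by exists a => //; apply/andP; split; apply/asboolPn.
Qed.

(* Main.v *)
From mathcomp Require Import all_boot all_order all_algebra all_classical.
From mathcomp Require wochoice.
Require Import Defs.

Set Implicit Arguments.
Unset Strict Implicit.
Unset Printing Implicit Defensive.

(* Let [dd K] be the supremum of the numbers of branches of trees with [K] nodes
   and height at most [mu]; then [dd K <= ded K].  Put [D0 = mu],
   [D(i+1) = dd Di] and suppose [D4 < 2^mu].  The full binary tree of the least
   height with more than [D4] branches has at most [D4] nodes, so it is enough
   to cover all subsets of [D4] of size at most [mu] by [D4] sets of size [D3]:
   each such set carries at most [D4] branches.  Coding the elements of [dd A]
   as branches through [A] reduces this to covering the subsets of [D1] by [D4]
   sets of size [mu], and approximating ordinals from above reduces that to
   dominating products of at most [mu] ordinals below [D1] by [D3] functions.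

   For the products we argue as in pcf theory.  A product is [K]-good if there
   is a strategy for building increasing chains of length [mu^+] with only [K]
   possible suprema.  An increasing union of [K]-good sets of coordinates is
   [dd K]-good, since the suprema are branches of a tree with [K] nodes, and a
   product is [D1]-directed modulo its [D1]-good sets.  Take the least ordinal
   [nu] below which some product is not [D1]-good: all products below [nu] are
   [D2]-good, and the failure of goodness yields, by club guessing and least
   upper bounds in an ultraproduct, for every ordinal below [D1] of large
   cofinality an unbounded family in a product below [nu]; hence all products
   below [D1] are dominated by [D2] functions. *)

(** * Choice and cardinal comparison *)

(** The supremum that defines [dd] need not be attained, so no single tree may be assumed to have
    [dd K] branches, and no cardinal arithmetic is available to count functions. Goodness counts
    suprema of chains instead. A strategy imposes lower bounds only, so one chain can follow [mu]
    strategies at once; this gives the closure properties of good sets. Chains have length [mu^+]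
    because [mu] coordinates cannot tell [mu^+] stages apart: several contradictions below are an
    injection of [mu^+] into [mu] or into its square.

    Coordinates are required to have cofinality above [mu^+++], because club guessing with ladders
    of length [mu^+] takes place in [mu^+++], its proof running through [mu^++] clubs. The price is
    affordable by the hypothesis that is being refuted: while [D4 < 2^mu], each passage from [K] to
    [dd K] is strict, so [mu^+], [mu^++], [mu^+++] are at most [D1], [D2], [D3], and the coordinates
    of these cofinalities are dominated by listing cofinal sequences. *)

Definition epsilon_or (T : Type) (x0 : T) (P : T -> Prop) : T :=
  if pselect (exists x, P x) is left h then projT1 (cid h) else x0.

Lemma epsilon_orP (T : Type) (x0 : T) (P : T -> Prop) :
  (exists x, P x) -> P (epsilon_or x0 P).
Proof. by rewrite /epsilon_or; case: pselect => // h _; case: (cid h). Qed.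

Lemma fun_choice (A B : Type) (R : A -> B -> Prop) :
  (forall a, exists b, R a b) -> exists f : A -> B, forall a, R a (f a).
Proof. by move=> h; exists (fun a => projT1 (cid (h a))) => a; case: (cid (h a)). Qed.

Lemma not_forall_ex (A : Type) (P : A -> Prop) :
  ~ (forall a, P a) -> exists a, ~ P a.
Proof. by move=> h; apply: contrapT => k; apply: h => a; apply: contrapT => q; apply: k; exists a. Qed.

Lemma sig_val_inj (A : Type) (P : A -> Prop) (x y : {a | P a}) :
  proj1_sig x = proj1_sig y -> x = y.
Proof.
by case: x => x px; case: y => y py /= xy; move: px py; rewrite xy => px py; congr exist; exact: Prop_irrelevance.
Qed.

Definition cle (A B : Type) : Prop := exists f : A -> B, injective f.

Lemma cle_le_cardinal (A B : Type) : cle A B <-> le_cardinal A B.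
Proof.
split=> [[f /inj_card_leT] //|/card_leP[f]].
exists (fun a => val (f (SigSub (mem_set (Logic.I : [set: A]%classic a))))) => a b /val_inj.
have /(_ (SigSub (mem_set (Logic.I : [set: A]%classic a))) (SigSub (mem_set (Logic.I : [set: A]%classic b)))) := 'inj_f.
by rewrite !inE => /(_ Logic.I Logic.I)/[apply] /(congr1 val).
Qed.

Lemma cle_refl A : cle A A.
Proof. by exists id. Qed.

Lemma cle_trans B A C : cle A B -> cle B C -> cle A C.
Proof. by move=> [f fi] [g gi]; exists (g \o f); exact: inj_comp. Qed.

Lemma cle_total A B : cle A B \/ cle B A.
Proof. by have [/cle_le_cardinal|/cle_le_cardinal] := card_le_total A B; [left|right]. Qed.

Lemma not_cle A B : ~ cle A B -> cle B A.
Proof. by have [|] := cle_total A B. Qed.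

Lemma cle_sig A (P : A -> Prop) : cle {a | P a} A.
Proof. by exists (@proj1_sig _ _) => x y; exact: sig_val_inj. Qed.

Lemma cle_prod A B C D : cle A C -> cle B D -> cle (A * B) (C * D).
Proof.
move=> [f fi] [g gi]; exists (fun p => (f p.1, g p.2)) => -[a b] [a' b'] /=.
by move=> [/fi -> /gi ->].
Qed.

Lemma cle_surj A B (g : B -> A) : (forall a, exists b, g b = a) -> cle A B.
Proof.
move=> /fun_choice[f fP]; exists f => a a' ff.
by rewrite -(fP a) -(fP a') ff.
Qed.

Lemma cle_reindex A B Y (h : A -> Y) (y0 : Y) :
  cle A B -> exists k : B -> Y, forall a, exists b, k b = h a.
Proof.
move=> [f fi].
exists (fun b => epsilon_or y0 (fun y => exists a, f a = b /\ h a = y)) => a.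
exists (f a); have [|a' [/fi -> //]] := @epsilon_orP _ y0 (fun y => exists a0, f a0 = f a /\ h a0 = y).
by exists (h a), a.
Qed.

Lemma cle_bigcup I A K (P : I -> A -> Prop) : (forall a, exists i, P i a) ->
  (forall i, cle {a | P i a} K) -> cle A (I * K).
Proof.
move=> /fun_choice[i iP] h.
pose f j := projT1 (cid (h j)); have fi j : injective (f j) by rewrite /f; case: cid.
exists (fun a => (i a, f (i a) (exist _ a (iP a)))) => a b [iab].
suff gen j (pb : P j b) : i a = j -> f (i a) (exist _ a (iP a)) = f j (exist _ b pb) -> a = b.
  exact: gen.
by move=> ij; move: pb; rewrite -ij => pb /fi/(congr1 (@proj1_sig _ _)).
Qed.

(** * Well-orders *)

Record woset := Woset {
  wcar :> Type;
  wpt : wcar;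
  wlt : wcar -> wcar -> Prop;
  wlt_trans : forall y x z, wlt x y -> wlt y z -> wlt x z;
  wlt_total : forall x y, [\/ x = y, wlt x y | wlt y x];
  wlt_min : forall P : wcar -> Prop, (exists x, P x) ->
    exists2 x, P x & forall y, P y -> ~ wlt y x }.

Notation "x ≺ y" := (wlt x y) (at level 70, no associativity).
Definition wle (W : woset) (x y : W) : Prop := ~ y ≺ x.
Notation "x ≼ y" := (wle x y) (at level 70, no associativity).

Section WosetTheory.
Variable W : woset.
Implicit Types (x y z w : W) (P S : W -> Prop).

Lemma wlt_irr x : ~ x ≺ x.
Proof. by move=> xx; have [|y <- /(_ x erefl)] := @wlt_min W (eq x); first by exists x. Qed.

Lemma wle_refl x : x ≼ x. Proof. exact: wlt_irr. Qed.

Lemma wltW x y : x ≺ y -> x ≼ y.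
Proof. by move=> xy yx; apply: (@wlt_irr x); exact: wlt_trans yx. Qed.

Lemma wle_eqVlt x y : x ≼ y -> x = y \/ x ≺ y.
Proof. by have [->|?|?] := wlt_total x y; [left|right|]. Qed.

Lemma wle_lt_trans y x z : x ≼ y -> y ≺ z -> x ≺ z.
Proof. by move=> /wle_eqVlt[-> //|]; exact: wlt_trans. Qed.

Lemma wlt_le_trans y x z : x ≺ y -> y ≼ z -> x ≺ z.
Proof. by move=> xy /wle_eqVlt[<- //|]; exact: wlt_trans. Qed.

Lemma wle_trans y x z : x ≼ y -> y ≼ z -> x ≼ z.
Proof. by move=> xy yz zx; apply: xy; exact: wle_lt_trans zx. Qed.

Lemma wle_anti x y : x ≼ y -> y ≼ x -> x = y.
Proof. by move=> /wle_eqVlt[]. Qed.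

Lemma wltP x y : x ≺ y \/ y ≼ x.
Proof. by have [->|?|/wltW] := wlt_total x y; [right|left|right] => //; exact: wlt_irr. Qed.

Lemma wlt_neq x y : x ≺ y -> x <> y.
Proof. by move=> + xy; rewrite xy; exact: wlt_irr. Qed.

Lemma wind P : (forall w, (forall v, v ≺ w -> P v) -> P w) -> forall w, P w.
Proof.
move=> h w; apply: contrapT => nP.
have [|x nPx xmin] := @wlt_min W (fun x => ~ P x); first by exists w.
by apply: nPx; apply: h => v vx; apply: contrapT => /xmin.
Qed.

Lemma wlt_wf : well_founded (@wlt W).
Proof. by move=> w; elim/wind: w => w ih; constructor. Qed.

Definition wmin P : W := epsilon_or (wpt W) (fun x => P x /\ forall y, P y -> x ≼ y).

Lemma wminP P : (exists x, P x) -> P (wmin P) /\ forall y, P y -> wmin P ≼ y.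
Proof. 
move=> /wlt_min[x Px xm].
by apply: (@epsilon_orP _ _ (fun x => P x /\ forall y, P y -> x ≼ y)); exists x.
 Qed.

Definition wbot : W := wmin (fun=> True).

Lemma wbot_le x : wbot ≼ x.
Proof. by have [|_ h] := @wminP (fun=> True); [exists x|exact: h]. Qed.

(** [wmin] falls back to a default point, so this is a supremum only when [S] is bounded; [wlub_ub]
    therefore asks for a bound. *)
Definition wlub S : W := wmin (fun x => forall y, S y -> y ≼ x).

Lemma wlub_ub S x y : (forall y, S y -> y ≼ x) -> S y -> y ≼ wlub S.
Proof. by move=> ub; have [|h _] := @wminP (fun x => forall y, S y -> y ≼ x); [exists x|exact: h]. Qed.

Lemma wlub_least S x : (forall y, S y -> y ≼ x) -> wlub S ≼ x.
Proof. by move=> ub; have [|_ h] := @wminP (fun x => forall y, S y -> y ≼ x); [exists x|exact: h]. Qed.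

Lemma wlub_lt S x : x ≺ wlub S -> exists2 y, S y & x ≺ y.
Proof.
move=> xl; apply: contrapT => h; apply: (@wlub_least S x) xl => y Sy xy.
by apply: h; exists y.
Qed.

Definition wmax x y : W := if pselect (x ≺ y) then y else x.

Lemma wmax_l x y : x ≼ wmax x y.
Proof. by rewrite /wmax; case: pselect => h; [exact: wltW|exact: wlt_irr]. Qed.

Lemma wmax_r x y : y ≼ wmax x y.
Proof. by rewrite /wmax; case: pselect => h; [exact: wlt_irr|]. Qed.

Lemma wmax_lt x y z : x ≺ z -> y ≺ z -> wmax x y ≺ z.
Proof. by rewrite /wmax; case: pselect. Qed.

Lemma wmax_le x y z : x ≼ z -> y ≼ z -> wmax x y ≼ z.
Proof. by rewrite /wmax; case: pselect. Qed.

(** Recursion by choice: [R] may look only at earlier values, and a value must exist only when the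
    earlier ones satisfy [R]. Invariants are often put into [R] as premises on the earlier values
    and discharged afterwards by induction. *)
Lemma wrec (Y : Type) (y0 : Y) (R : W -> (W -> Y) -> Y -> Prop) :
  (forall w g g' u, (forall v, v ≺ w -> g v = g' v) -> R w g u -> R w g' u) ->
  (forall w g, (forall v, v ≺ w -> R v g (g v)) -> exists u, R w g u) ->
  exists g : W -> Y, forall w, R w g (g w).
Proof.
move=> loc ex.
pose trunc w (rec : forall v, v ≺ w -> Y) v :=
  if pselect (v ≺ w) is left h then rec v h else y0.
pose F w rec := epsilon_or y0 (R w (trunc w rec)).
pose g := Fix wlt_wf (fun=> Y) F.
have truncE w v : v ≺ w -> trunc w (fun v _ => g v) v = g v.
  by move=> vw; rewrite /trunc; case: pselect.
have gE w : g w = epsilon_or y0 (R w (trunc w (fun v _ => g v))).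
  rewrite /g Fix_eq // => x f f' ff; congr F.
  by apply: functional_extensionality_dep => v; apply: functional_extensionality_dep => h; exact: ff.
exists g; elim/wind => w ih.
rewrite gE; apply: (loc _ (trunc w (fun v _ => g v))) => [v|]; first exact: truncE.
apply: epsilon_orP; apply: ex => v vw; rewrite truncE //.
apply: loc (ih _ vw) => u uv; rewrite truncE //; exact: wlt_trans vw.
Qed.

Definition seg w : Type := {v | v ≺ w}.

Lemma cle_seg w w' : w ≼ w' -> cle (seg w) (seg w').
Proof.
move=> ww; exists (fun v : seg w => exist (fun v => v ≺ w') (proj1_sig v) (wlt_le_trans (proj2_sig v) ww)) => x y [].
exact: sig_val_inj.
Qed.

(* Greedily send each point to a value not used before. *)
Lemma cle_of_segs (K : Type) : (forall w, ~ cle K (seg w)) -> cle W K.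
Proof.
move=> h.
have [k0] : exists k0 : K, True.
  by apply: contrapT => k; apply: (h (wpt W)); exists (fun k1 : K => False_rect _ (k (ex_intro _ k1 Logic.I))) => k1; case: k; exists k1.
move=> _; have [||e eP] := @wrec K k0 (fun w g u => forall v, v ≺ w -> g v <> u).
- by move=> w g g' y gg R v vw; rewrite -gg //; exact: R.
- move=> w g _; apply: contrapT => k; apply: (h w).
  have ex (u : K) : exists v : seg w, g (proj1_sig v) = u.
    apply: contrapT => nv; apply: k; exists u => v vw gv.
    by apply: nv; exists (exist _ v vw).
  exact: cle_surj ex.
exists e => x y exy; have [//|xy|yx] := wlt_total x y.
  by have := eP _ _ xy.
by have := eP _ _ yx; rewrite exy.
Qed.

End WosetTheory.

Arguments wlub {W} S.
Arguments wmin {W} P.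
Arguments wmax {W} x y.

Lemma exists_woset (A : Type) (a0 : A) : exists W : woset, wcar W = A.
Proof.
have [R Rwo] := wochoice.well_ordering_principle {classic A}.
have Rmin (P : A -> Prop) : (exists x, P x) ->
    exists x, P x /\ forall y, P y -> R x y.
  move=> [x Px]; have [|z [[zP zm] _]] := Rwo [pred x | `[< P x >]].
    by exists x; exact/asboolP.
  exists z; split; first by move: zP => /asboolP.
  by move=> y Py; apply: zm; exact/asboolP.
have Rrefl x : R x x.
  by have [|y [<- h]] := Rmin (eq x); [exists x|exact: h].
have Ranti x y : R x y -> R y x -> x = y.
  move=> xy yx; have [|z [_ zu]] := Rwo [pred z : {classic A} | (z == x) || (z == y)].
    by exists x; rewrite inE eqxx.
  have -> : x = z.
    by apply/esym/zu; split; rewrite ?inE ?eqxx // => u; rewrite inE => /orP[] /eqP ->.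
  by apply: zu; split; rewrite ?inE ?eqxx ?orbT // => u; rewrite inE => /orP[] /eqP ->.
have Rtot x y : R x y \/ R y x.
  have [|z [[->|->] zm]] := Rmin (fun z => z = x \/ z = y); first by exists x; left.
    by left; apply: zm; right.
  by right; apply: zm; left.
have Rtrans y x z : R x y -> R y z -> R x z.
  move=> xy yz; have [|u [uP um]] := Rmin (fun u => [\/ u = x, u = y | u = z]).
    by exists x; constructor 1.
  case: uP => uE; subst u.
  - by apply: um; constructor 3.
  - by rewrite (Ranti _ _ xy (um _ (Or31 _ _ erefl))).
  - by rewrite -(Ranti _ _ yz (um _ (Or32 _ _ erefl))).
pose lt x y := R x y /\ x <> y.
have lt_trans y x z : lt x y -> lt y z -> lt x z.
  move=> [xy nxy] [yz _]; split; first exact: Rtrans yz.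
  by move=> xz; apply: nxy; apply: Ranti => //; rewrite xz.
have lt_tot x y : [\/ x = y, lt x y | lt y x].
  have [->|nxy] := pselect (x = y); first by constructor 1.
  have [|] := Rtot x y; first by constructor 2.
  by constructor 3; split => // /esym.
have lt_min (P : A -> Prop) : (exists x, P x) -> exists2 x, P x & forall y, P y -> ~ lt y x.
  move=> /Rmin[x [Px xm]]; exists x => // y /xm xy [yx]; apply.
  exact: Ranti.
by exists (Woset a0 lt_trans lt_tot lt_min).
Qed.

Section Pullback.
Variables (A : Type) (a0 : A) (W : woset) (f : A -> W) (fi : injective f).

Definition wpull : woset.
Proof.
refine (@Woset A a0 (fun x y => f x ≺ f y) _ _ _).
- by move=> y x z; exact: wlt_trans.
- by move=> x y; have [/fi ->|?|?] := wlt_total (f x) (f y); [constructor 1|constructor 2|constructor 3].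
- move=> P [x Px]; have [|_ [y [Py <-]] ym] := @wlt_min W (fun w => exists x, P x /\ f x = w).
    by exists (f x), x.
  by exists y => // z Pz; apply: ym; exists z.
Defined.
End Pullback.

Section Lex.
Variables (W W' : woset).

Definition wlex : woset.
Proof.
refine (@Woset (W * W') (wpt W, wpt W')
  (fun x y => x.1 ≺ y.1 \/ x.1 = y.1 /\ x.2 ≺ y.2) _ _ _).
- move=> y x z [xy|[-> xy]] [yz|[yz yz']]; [left|left|left|right].
  + exact: wlt_trans yz.
  + by rewrite -yz.
  + by [].
  + by split=> //; exact: wlt_trans yz'.
- move=> [a b] [c d] /=; have [->|?|?] := wlt_total a c;
    [|by constructor 2; left|by constructor 3; left].
  by have [->|?|?] := wlt_total b d; [constructor 1|constructor 2; right|constructor 3; right].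
- move=> P [[a b] Pab].
  have [|a1 [b1 P1] a1m] := @wlt_min W (fun a => exists b, P (a, b)); first by exists a, b.
  have [|b2 P2 b2m] := @wlt_min W' (fun b => P (a1, b)); first by exists b1.
  exists (a1, b2) => // -[c d] Pcd /= [ca|[ca db]].
    by apply: a1m ca; exists d.
  by apply: b2m db; rewrite -ca.
Defined.
End Lex.

Section Top.
Variable W : woset.

Definition wtop : woset.
Proof.
refine (@Woset (option W) None (fun x y =>
  match x, y with Some a, Some b => a ≺ b | Some _, None => True | None, _ => False end) _ _ _).
- by move=> [y|] [x|] [z|] //; exact: wlt_trans.
- move=> [x|] [y|]; [|by constructor 2|by constructor 3|by constructor 1].
  by have [->|?|?] := wlt_total x y; [constructor 1|constructor 2|constructor 3].
- move=> P [x Px]; have [[a Pa]|h] := pselect (exists a, P (Some a)).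
    have [|b Pb bm] := @wlt_min W (fun a => P (Some a)); first by exists a.
    exists (Some b) => //; case=> [c Pc|_ //]; exact: (bm c Pc).
  exists x => //; case=> [c Pc|_ []]; case: h; by exists c.
Defined.

Lemma wtop_le (x : wtop) : x ≼ (None : wtop). Proof. by []. Qed.
End Top.

(** Take the least [v] such that [seg v] has room for all of [W] and pull the order back along the
    injection. A proper segment of the new order sits inside some [seg u] with [u ≺ v], too small by
    the choice of [v]. *)
Lemma exists_initial_woset (A : Type) (a0 : A) :
  exists W : woset, wcar W = A /\ forall w : W, ~ cle W (seg w).
Proof.
have [W WA] := exists_woset a0.
have [[w wP]|h] := pselect (exists w : W, cle W (seg w)); last first.
  by exists W; split => // w cw; apply: h; exists w.
have [|[f fi] vm] := @wminP W (fun w => cle W (seg w)); first by exists w.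
set v := wmin _ in f fi vm.
have gi : injective (fun a => proj1_sig (f a)) by move=> a b /sig_val_inj /fi.
exists (wpull (wpt W) gi); split => // x [h hi].
apply: (vm (proj1_sig (f x))) (proj2_sig (f x)).
exists (fun a => exist _ (proj1_sig (f (proj1_sig (h a)))) (proj2_sig (h a))) => a b.
by case=> /gi /sig_val_inj /hi.
Qed.

(** * Infinite cardinals are idempotent *)

Lemma finite_cle_nat A : ~ cle nat A -> finite_set [set: A]%classic.
Proof. by move=> h; apply: contrapT => /infiniteP/cle_le_cardinal. Qed.

Lemma cle_option_nat A : cle nat A -> cle (option A) A.
Proof.
move=> [f fi].
pose g (a : option A) : A := if a is Some a then
  (if pselect (exists n, f n = a) is left h then f (projT1 (cid h)).+1 else a) else f 0.
exists g; move=> [a|] [b|] //=.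
- case: pselect => [ha|ha]; case: pselect => [hb|hb].
  + by case: (cid ha) => n /= <-; case: (cid hb) => m /= <- /fi[->].
  + by move=> e; case: hb; eexists; exact: e.
  + by move=> e; case: ha; eexists; exact: esym e.
  + by move->.
- by case: pselect => [ha /fi //|ha e]; case: ha; exists 0.
- by case: pselect => [ha /fi //|ha e]; case: ha; exists 0.
Qed.

(** Hessenberg's argument. After a reduction to the case where no smaller segment has the size of
    [seg w], order pairs by maximum and then lexicographically: the pairs before a given one live in
    the square of a smaller set, to which induction or finiteness applies. *)
Lemma cle_seg_square (W : woset) (w : W) : cle nat (seg w) -> cle (seg w * seg w) (seg w).
Proof.
elim/wind: w => w ih ninf.
have [|c wm] := @wminP W (fun v => cle (seg w) (seg v)).
  by exists w; exact: cle_refl.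
set v := wmin _ in c wm.
have vw : v ≼ w by apply: wm; exact: cle_refl.
have [vE|{}vw] := wle_eqVlt vw; last first.
  apply: cle_trans (cle_prod c c) _; apply: cle_trans (ih _ vw _) _.
    exact: cle_trans ninf c.
  by apply: cle_seg; exact: wltW.
have {v wm c vE vw} ini u : u ≺ w -> ~ cle (seg w) (seg u).
  by move=> uw /wm; rewrite vE.
have [n0 _] := ninf; pose a0 : seg w := n0 0.
pose key (p : seg w * seg w) : wlex W (wlex W W) :=
  let a := proj1_sig p.1 in let b := proj1_sig p.2 in (wmax a b, (a, b)).
have keyi : injective key by move=> [a b] [c d] [_] /sig_val_inj -> /sig_val_inj ->.
apply: (@cle_of_segs (wpull (a0, a0) keyi)) => -[a b] h.
set m := wmax (proj1_sig a) (proj1_sig b).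
have mw : m ≺ w by apply: wmax_lt; [case: (a)|case: (b)].
pose Sm := option (seg m).
have inS u : u ≼ m -> exists s : Sm, if s is Some s then proj1_sig s = u else u = m.
  by move=> /wle_eqVlt[->|um]; [exists None|exists (Some (exist _ u um))].
have segS : cle (@seg (wpull (a0, a0) keyi) (a, b)) (Sm * Sm).
  have ex (q : @seg (wpull (a0, a0) keyi) (a, b)) : exists s : Sm * Sm,
     (if s.1 is Some s then proj1_sig s = proj1_sig (proj1_sig q).1 else proj1_sig (proj1_sig q).1 = m) /\
     (if s.2 is Some s then proj1_sig s = proj1_sig (proj1_sig q).2 else proj1_sig (proj1_sig q).2 = m).
    case: q => -[c d] /= cd.
    have le : wmax (proj1_sig c) (proj1_sig d) ≼ m.
      by case: cd => /= [/wltW //|[-> _]]; exact: wlt_irr.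
    have [|s sP] := inS (proj1_sig c); first by apply: (wle_trans _ le); exact: wmax_l.
    have [|t tP] := inS (proj1_sig d); first by apply: (wle_trans _ le); exact: wmax_r.
    by exists (s, t).
  have [e eP] := fun_choice ex; exists e => x y exy.
  have := eP x; rewrite exy; have := eP y.
  case: x y {exy} => -[c d] ? [[c' d'] ?] /= => -[h1 h2] [h3 h4].
  apply: sig_val_inj => /=; congr pair; apply: sig_val_inj.
    by move: h1 h3; case: (e _).1 => [s <- <-|-> ->].
  by move: h2 h4; case: (e _).2 => [s <- <-|-> ->].
have {}h := cle_trans h segS.
have [nm|nm] := pselect (cle nat (seg m)).
  apply: (ini m mw); apply: cle_trans h _.
  apply: cle_trans (ih _ mw nm).
  by apply: cle_prod; exact: cle_option_nat.
have fS : finite_set [set: Sm]%classic.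
  have := finite_cle_nat nm => fm.
  rewrite (_ : [set: Sm] = [set None] `|` Some @` [set: seg m])%classic; last first.
    by apply/seteqP; split => // -[x _|_]; [right; exists x|left].
  by rewrite finite_setU; split; [exact: finite_set1|exact: finite_image].
have fSS : finite_set [set: Sm * Sm]%classic.
  by rewrite -setXTT; exact: finite_setX.
have := cle_trans ninf h => /cle_le_cardinal /infiniteP; exact.
Qed.

Lemma cle_square K : cle nat K -> cle (K * K) K.
Proof.
move=> ninf; have [f fi] := ninf; have [W WK] := exists_woset (f 0).
subst K; have KS : cle W (@seg (wtop W) None).
  by exists (fun x => exist _ (Some x) Logic.I) => x y [].
have SK : cle (@seg (wtop W) None) W.
  have ex (x : @seg (wtop W) None) : exists y, proj1_sig x = Some y.
    by case: x => -[y|] h; [exists y|case: h].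
  have [e eP] := fun_choice ex; exists e => x y exy.
  by apply: sig_val_inj; rewrite !eP exy.
apply: cle_trans (cle_prod KS KS) _; apply: cle_trans SK.
apply: cle_seg_square; exact: cle_trans KS.
Qed.

(** * Successor cardinals and cofinalities *)

Definition wsucc (A : Type) (W : woset) : Prop := (forall w : W, cle (seg w) A) /\ ~ cle W A.

Lemma cantor (A : Type) : ~ cle (A -> Prop) A.
Proof.
move=> [f fi]; pose D a := exists P, f P = a /\ ~ P a.
have [[P [/fi PE nP]]|nD] := pselect (D (f D)).
  by apply: (nP); rewrite {1}PE; exists P; rewrite {1}PE.
by apply: (nD); exists D.
Qed.

Lemma exists_wsucc (A : Type) : exists W : woset, wsucc A W.
Proof.
have [W WE] := @exists_woset (A -> Prop) (fun=> True).
have nW : ~ cle W A by rewrite WE; exact: cantor.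
have [[w wP]|h] := pselect (exists w : W, ~ cle (seg w) A); last first.
  by exists W; split => // w; apply: contrapT => nw; apply: h; exists w.
have [|nv vm] := @wminP W (fun w => ~ cle (seg w) A); first by exists w.
set v := wmin _ in nv vm.
have [x0 _] : exists x0 : seg v, True.
  apply: contrapT => k; apply: nv.
  by exists (fun x => False_rect _ (k (ex_intro _ x Logic.I))) => x; case: k; exists x.
have pi : injective (@proj1_sig _ (fun u => u ≺ v)) by move=> x y; exact: sig_val_inj.
exists (wpull x0 pi); split => // x.
have : cle (seg (proj1_sig x)) A.
  by apply: contrapT => /vm; apply; exact: (proj2_sig x).
apply: cle_trans.
exists (fun y : @seg (wpull x0 pi) x => exist (fun u => u ≺ proj1_sig x) (proj1_sig (proj1_sig y)) (proj2_sig y)) => y z [].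
by move=> /sig_val_inj /sig_val_inj.
Qed.

Lemma cle_initial_closed (W : woset) (w : W) A : cle nat A -> cle (seg w) A ->
  cle {v | v ≼ w} A.
Proof.
move=> An sA; apply: cle_trans (cle_option_nat An).
have [f fi] := sA.
exists (fun v : {v | v ≼ w} => if pselect (proj1_sig v ≺ w) is left h then Some (f (exist _ (proj1_sig v) h)) else None) => x y.
case: pselect => [hx|hx]; case: pselect => [hy|hy] //.
  by move=> [/fi []]; exact: sig_val_inj.
move=> _; apply: sig_val_inj.
have [->|//] := wle_eqVlt (proj2_sig x); have [->|//] := wle_eqVlt (proj2_sig y); by [].
Qed.

Section Successor.
Variables (A : Type) (W : woset).
Hypotheses (An : cle nat A) (sAW : wsucc A W).

Lemma wsucc_bounded B (h : B -> W) : cle B A -> exists w, forall b, h b ≺ w.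
Proof.
move=> BA; apply: contrapT => nb; apply: sAW.2.
have ex w : exists b, w ≼ h b.
  by apply: contrapT => k; apply: nb; exists w => b; apply: contrapT => hb; apply: k; exists b.
apply: cle_trans (cle_bigcup ex _) _; last first.
  apply: cle_trans (cle_square An); exact: cle_prod (BA) (@cle_refl A).
move=> b; exact: cle_initial_closed (sAW.1 _).
Qed.

Lemma wsucc_cle : cle A W.
Proof. exact: not_cle sAW.2. Qed.

Lemma wsucc_nat : cle nat W.
Proof. exact: cle_trans wsucc_cle. Qed.

Lemma wsucc_nolast (w : W) : exists w', w ≺ w'.
Proof.
have [n ni] := An; have [|w' h] := @wsucc_bounded A (fun=> w); first exact: cle_refl.
by exists w'; exact: (h (n 0)).
Qed.

Lemma wsucc_enum (w : W) : exists e : A -> W, forall v, v ≺ w -> exists a, e a = v.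
Proof.
have [k kP] := cle_reindex (@proj1_sig _ (fun v => v ≺ w)) w (sAW.1 w).
by exists k => v vw; have [a aE] := kP (exist _ v vw); exists a.
Qed.

Lemma wsucc_least D : ~ cle D A -> cle W D.
Proof. by move=> nD; apply: cle_of_segs => w dw; apply: nD; exact: cle_trans (sAW.1 w). Qed.

Lemma wsucc_omega (u : nat -> W) : exists w, forall n, u n ≺ w.
Proof. exact: wsucc_bounded. Qed.
End Successor.

(** Cofinality of [b] greater than the size of [A]. The strict bound rules out successors [b] as
    soon as [A] is inhabited. *)
Definition cofgt (A : Type) (O : woset) (b : O) : Prop :=
  (exists x, x ≺ b) /\
  forall h : A -> O, (forall a, h a ≺ b) -> exists2 x, x ≺ b & forall a, h a ≺ x.

Lemma cofgt_cle A B (O : woset) (b : O) : cle B A -> cofgt A b -> cofgt B b.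
Proof.
move=> [f fi] [[x xb] cA]; split; first by exists x.
move=> h hb.
pose k a := epsilon_or x (fun y => exists c, f c = a /\ h c = y).
have kf c : k (f c) = h c.
  have [|c' [/fi cc ch]] := @epsilon_orP _ x (fun y => exists c0, f c0 = f c /\ h c0 = y).
    by exists (h c), c.
  by rewrite -cc ch cc.
have [|y yb ky] := cA k.
  move=> a; have [[c ca]|nc] := pselect (exists c, f c = a); first by rewrite -ca kf.
  by rewrite /k /epsilon_or; case: pselect => // h0; exfalso; case: h0 => y [c [ca _]]; apply: nc; exists c.
by exists y => // c; rewrite -kf.
Qed.

Lemma cofgt_next A (O : woset) (b x : O) : cle nat A -> cofgt A b -> x ≺ b ->
  exists2 y, x ≺ y & y ≺ b.
Proof.
move=> [n _] [_ h] xb; have [|y yb xy] := h (fun=> x) => //.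
by exists y => //; exact: (xy (n 0)).
Qed.

Lemma not_cofgt A (O : woset) (b : O) : (exists x, x ≺ b) -> ~ cofgt A b ->
  exists h : A -> O, (forall a, h a ≺ b) /\ forall x, x ≺ b -> exists a, x ≼ h a.
Proof.
move=> bx nc; apply: contrapT => k; apply: nc; split=> // h hb.
apply: contrapT => nx; apply: k; exists h; split=> // x xb.
apply: contrapT => na; apply: nx; exists x => // a.
by apply: contrapT => ha; apply: na; exists a.
Qed.

(** * Normal functions and club guessing *)

(** The bottom point counts as a limit, vacuously. Hence a normal function sends bottom to bottom,
    and a [club] contains the bottom point. *)
Definition wlimit (W : woset) (t : W) : Prop := forall s, s ≺ t -> exists2 r, s ≺ r & r ≺ t.

Definition normal_to (V W : woset) (n : V -> W) (x : W) : Prop :=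
  [/\ forall s t, s ≺ t -> n s ≺ n t, forall t, n t ≺ x,
      forall y, y ≺ x -> exists t, y ≺ n t
    & forall t, wlimit t -> forall y, (forall s, s ≺ t -> n s ≼ y) -> n t ≼ y].

(** The closing-off argument behind the club lemmas: iterate the step [F] along [nat] and take the
    supremum. *)
Lemma omega_limit (V : woset) (F : V -> V -> Prop) (v0 : V) :
  (forall u : nat -> V, exists w, forall n, u n ≺ w) ->
  (forall v, exists2 v', v ≺ v' & F v v') ->
  exists t (u : nat -> V), [/\ v0 ≺ t, wlimit t, forall n, u n ≺ t, forall n, F (u n) (u n.+1)
    & forall s, s ≺ t -> exists n, s ≺ u n].
Proof.
move=> om ex.
have [f fP] : exists f, forall v, v ≺ f v /\ F v (f v).
  apply: (@fun_choice V V (fun v v' => v ≺ v' /\ F v v')) => v.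
  by have [v' ? ?] := ex v; exists v'.
pose u n := iter n f v0.
have um n : u n ≺ u n.+1 by exact: (fP _).1.
have [w uw] := om u.
pose S x := exists n, u n = x.
have uS n : u n ≼ wlub S.
  by apply: (@wlub_ub _ _ w) => [y [m <-]|]; [exact/wltW|exists n].
have ult n : u n ≺ wlub S by exact: wlt_le_trans (um n) (uS n.+1).
have uex s : s ≺ wlub S -> exists n, s ≺ u n.
  by move=> /wlub_lt[_ [n <-] sn]; exists n.
exists (wlub S), u; split=> //.
- exact: (ult 0).
- by move=> s /uex[n sn]; exists (u n).
- by move=> n; exact: (fP _).2.
Qed.

Section Clubs.
Variable T : woset.

Definition limit_of (E : T -> Prop) (t : T) : Prop :=
  forall s, s ≺ t -> exists e, [/\ s ≺ e, e ≺ t & E e].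

Definition club (E : T -> Prop) : Prop :=
  (forall t, exists2 e, t ≺ e & E e) /\ (forall t, limit_of E t -> E t).

Lemma limit_ofW (E E' : T -> Prop) t : (forall e, E e -> E' e) -> limit_of E t -> limit_of E' t.
Proof. by move=> EE h s /h[e [? ? /EE ?]]; exists e. Qed.

Hypothesis om : forall u : nat -> T, exists w, forall n, u n ≺ w.

(** Both functions are cofinal in [x], so their values can be made to alternate; at the limit of the
    alternation continuity makes them equal. *)
Lemma club_agree (W : woset) (n n' : T -> W) (x : W) :
  normal_to n x -> normal_to n' x -> club (fun t => n t = n' t).
Proof.
move=> [nm nl nc nk] [nm' nl' nc' nk']; split=> [t|t lt].
  have [v|t' [u [tt lim ut uF ux]]] := @omega_limit T (fun v v' => n v ≺ n' v' /\ n' v ≺ n v') t om.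
    have [a va] := nc' _ (nl v); have [b vb] := nc _ (nl' v).
    have [w _ [vw aw bw]] : exists2 w, True & [/\ v ≺ w, a ≼ w & b ≼ w].
      have [w h] := om (fun k => if k is 0 then v else if k is 1 then a else b).
      by exists w => //; split; [exact: (h 0)|exact/wltW/(h 1)|exact/wltW/(h 2)].
    have le m (mm : forall s t, s ≺ t -> m s ≺ m t) (s r : T) : s ≼ r -> (m s : W) ≼ m r.
      by move=> /wle_eqVlt[->|/mm/wltW //]; exact: wle_refl.
    exists w => //; split; first exact: wlt_le_trans va (le _ nm' _ _ aw).
    exact: wlt_le_trans vb (le _ nm _ _ bw).
  exists t' => //; apply: wle_anti.
    apply: nk => // s /ux[k sk]; apply: wltW.
    apply: wlt_trans (nm _ _ sk) _; apply: wlt_trans (uF k).1 _; exact: nm'.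
  apply: nk' => // s /ux[k sk]; apply: wltW.
  apply: wlt_trans (nm' _ _ sk) _; apply: wlt_trans (uF k).2 _; exact: nm.
have lim : wlimit t by move=> s /lt[e [? ? _]]; exists e.
apply: wle_anti.
  apply: nk => // s /lt[e [se et ee]]; apply: wltW.
  by apply: wlt_trans (nm _ _ se) _; rewrite ee; exact: nm'.
apply: nk' => // s /lt[e [se et ee]]; apply: wltW.
by apply: wlt_trans (nm' _ _ se) _; rewrite -ee; exact: nm.
Qed.

Lemma club_inter (I : Type) (E : I -> T -> Prop) :
  (forall h : I -> T, exists w, forall i, h i ≺ w) ->
  (forall i, club (E i)) -> club (fun t => forall i, E i t).
Proof.
move=> bd Ec; split=> [t|t lt i]; last first.
  by apply: (Ec i).2; apply: limit_ofW lt.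
have [v|t' [u [tt lim ut uF ux]]] := @omega_limit T (fun v v' => forall i, exists e, [/\ v ≺ e, e ≺ v' & E i e]) t om.
  have [e eP] : exists e : I -> T, forall i, v ≺ e i /\ E i (e i).
    by apply: (@fun_choice I T (fun i e => v ≺ e /\ E i e)) => i; have [e ? ?] := (Ec i).1 v; exists e.
  have [w ew] := bd e; have [w' w'P] := om (fun k => if k is 0 then v else w).
  exists w'; first exact: (w'P 0).
  move=> i; exists (e i); split; [exact: (eP i).1| |exact: (eP i).2].
  exact: wlt_trans (ew i) (w'P 1).
exists t' => // i; apply: (Ec i).2 => s /ux[k sk].
have [e [ue eu Ee]] := uF k i; exists e; split=> //; first exact: wlt_trans sk ue.
exact: wlt_trans eu (ut _).
Qed.
End Clubs.

(** Shelah's club guessing. Either one club [E0] makes the traces of fixed ladders on [E0] guess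
    every club, or each club [E] is spoiled by a club [DD E]. In the second case the spoilers are
    intersected [W] times, and one ladder of length [V] would have to lose a new point at each of
    the [W] stages. *)
Theorem club_guessing (A : Type) (V W T : woset) :
  cle nat A -> wsucc A V -> wsucc V W -> wsucc W T ->
  exists (G : T -> Prop) (n : T -> V -> T) (Z : T -> V -> Prop),
    (forall d, G d -> (forall v w, v ≺ w -> n d v ≺ n d w) /\ forall w, exists2 z, w ≺ z & Z d z) /\
    forall E, club E -> exists2 d, G d & forall z, Z d z -> E (n d z).
Proof.
move=> An sV sW sT.
have Vn := wsucc_nat An sV; have Wn := wsucc_nat Vn sW.
have omT := wsucc_omega Wn sT; have omV := wsucc_omega An sV.
have [n nP] : exists n : T -> V -> T, forall d, (exists m : V -> T, normal_to m d) -> normal_to (n d) d.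
  apply: (@fun_choice T (V -> T) (fun d m => (exists m : V -> T, normal_to m d) -> normal_to m d)) => d.
  have [[m mP]|h] := pselect (exists m : V -> T, normal_to m d); first by exists m.
  by exists (fun=> d).
have [[E0 [E0c E0P]]|noE] := pselect (exists E0, club E0 /\ forall D, club D ->
    exists d, [/\ normal_to (n d) d, limit_of E0 d & forall z, E0 (n d z) -> D (n d z)]).
  exists (fun d => normal_to (n d) d /\ limit_of E0 d), n, (fun d z => E0 (n d z)).
  split=> [d [[nm nl nc nk] lE]|D /E0P[d [dn dl dD]]]; last by exists d.
  split=> // w.
  (* Ladder points need not lie in [E0]. Alternating [nat] many of them with points of [E0] produces
     a limit ladder point, which is in [E0] by closure. *)
  have [v|t [u [wt lim ut uF ux]]] := @omega_limit V (fun v v' => exists e, [/\ n d v ≺ e, e ≺ n d v' & E0 e]) w omV.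
    have [e [ve ed Ee]] := lE _ (nl v); have [v' ev'] := nc _ ed.
    exists v'; last by exists e.
    have [//|/wle_eqVlt[vv|/nm vv]] := wltP v v'.
      by case: (@wlt_irr _ e); apply: wlt_trans ve; rewrite -vv.
    by case: (@wlt_irr _ e); apply: wlt_trans ve; apply: wlt_trans vv.
  exists t => //; apply: E0c.2 => s st.
  have [v vt sv] : exists2 v, v ≺ t & s ≺ n d v.
    apply: contrapT => h; apply: (nk t lim s) => // v vt sv.
    by apply: h; exists v.
  have [k vk] := ux _ vt; have [e [ke ek Ee]] := uF k.
  exists e; split=> //.
    by apply: wlt_trans sv _; apply: wlt_trans (nm _ _ vk) ke.
  by apply: wlt_trans ek _; exact: nm.
exfalso.
have [DD DP] : exists DD : (T -> Prop) -> (T -> Prop), forall E, club E -> club (DD E) /\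
    forall d, normal_to (n d) d -> limit_of E d -> exists z, E (n d z) /\ ~ DD E (n d z).
  apply: (@fun_choice (T -> Prop) (T -> Prop) (fun E D => club E -> club D /\
    forall d, normal_to (n d) d -> limit_of E d -> exists z, E (n d z) /\ ~ D (n d z))) => E.
  have [Ec|nE] := pselect (club E); last by exists E.
  have [D DP] : exists D, ~ (club D -> exists d, [/\ normal_to (n d) d, limit_of E d & forall z, E (n d z) -> D (n d z)]).
    by apply: not_forall_ex => h; apply: noE; exists E.
  exists D => _; split; first by apply: contrapT => nD; apply: DP.
  move=> d dn dl; apply: contrapT => h; apply: DP => _; exists d; split=> // z Ez.
  by apply: contrapT => nDz; apply: h; exists z.
have [||E EE] := @wrec W (T -> Prop) (fun=> True)
    (fun w g y => y = (fun t => forall v, v ≺ w -> g v t /\ DD (g v) t)).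
- move=> w g g' _ gg ->; apply/funext => t; apply/propext.
  by split=> h v vw; [rewrite -gg|rewrite gg] => //; exact: h.
- by move=> w g _; eexists.
have Ec w : club (E w).
  elim/wind: w => w ih; rewrite EE.
  have -> : (fun t => forall v, v ≺ w -> E v t /\ DD (E v) t) =
      (fun t => forall i : seg w * bool, (if i.2 then E (proj1_sig i.1) else DD (E (proj1_sig i.1))) t).
    apply/funext => t; apply/propext; split=> [h [[v vw] []] /=|h v vw].
    - exact: (h v vw).1.
    - exact: (h v vw).2.
    by split; [exact: (h (exist _ v vw, true))|exact: (h (exist _ v vw, false))].
  apply: club_inter => // [h|[[v vw] []] /=]; last 2 first.
  - exact: ih.
  - by have [] := DP _ (ih _ vw).
  apply: (wsucc_bounded Wn sT); apply: cle_trans (cle_square Wn).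
  apply: cle_prod; first exact: cle_sig.
  apply: cle_trans Wn; exists (fun b : bool => if b then 0 else 1); by case=> -[].
pose Es t := forall w, E w t.
have Esc : club Es.
  by apply: club_inter => // h; apply: (wsucc_bounded Wn sT); exact: cle_refl.
pose nxt x := wmin (fun y => x ≺ y /\ Es y).
have nxtP x : x ≺ nxt x /\ Es (nxt x).
  by have [|] := @wminP T (fun y => x ≺ y /\ Es y); first by have [y ? ?] := Esc.1 x; exists y.
have [||e eE] := @wrec V T (wpt T) (fun w g y => y = wlub (fun x => exists2 v, v ≺ w & x = nxt (g v))).
- move=> w g g' _ gg ->; congr wlub; apply/funext => x; apply/propext.
  by split=> -[v vw ->]; exists v => //; rewrite gg.
- by move=> w g _; eexists.
have VW := wsucc_cle sW.
have eb w v : v ≺ w -> nxt (e v) ≼ e w.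
  move=> vw; rewrite (eE w).
  have [|x xP] := @wsucc_bounded W T Wn sT (seg w) (fun v => nxt (e (proj1_sig v))).
    by apply: cle_trans VW; exact: cle_sig.
  apply: (@wlub_ub _ _ x); last by exists v.
  by move=> _ [u uw ->]; apply: wltW; exact: (xP (exist _ u uw)).
have em v w : v ≺ w -> e v ≺ e w by move=> /eb; exact: wlt_le_trans (nxtP _).1.
pose d := wlub (fun x => exists v, x = e v).
have ed v : e v ≺ d.
  have [v' vv'] := wsucc_nolast An sV v.
  apply: wlt_le_trans (em _ _ vv') _.
  have [|x xP] := @wsucc_bounded W T Wn sT V e => //.
  by apply: (@wlub_ub _ _ x); [move=> _ [u ->]; exact/wltW|exists v'].
have dn : normal_to (n d) d.
  apply: nP; exists e; split=> //.
  - by move=> y /wlub_lt[_ [v ->] yv]; exists v.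
  - move=> t lim y h; rewrite eE; apply: wlub_least => _ [v vt ->].
    have [r vr rt] := lim _ vt; apply: (wle_trans (eb _ _ vr)); exact: h.
have dl : limit_of Es d.
  move=> s /wlub_lt[_ [v ->] sv]; exists (nxt (e v)); split.
  - exact: wlt_trans (nxtP _).1.
  - have [v' vv'] := wsucc_nolast An sV v; exact: wle_lt_trans (eb _ _ vv') (ed v').
  - exact: (nxtP _).2.
(* The point lost at stage [w]. All later clubs are inside [DD (E w)], so different stages lose
   different points and [z] injects [W] into [V]. *)
have [z zP] : exists z, forall w, E w (n d (z w)) /\ ~ DD (E w) (n d (z w)).
  apply: (@fun_choice W V (fun w z => E w (n d z) /\ ~ DD (E w) (n d z))) => w; apply: (DP _ (Ec w)).2 => //.
  by apply: limit_ofW dl.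
apply: sW.2; exists z => w w' zz.
have key u v : u ≺ v -> z u = z v -> False.
  move=> uv zuv; have [Ev _] := zP v; rewrite EE in Ev.
  by have [_] := Ev u uv; rewrite -zuv; exact: (zP u).2.
by have [//|/key/(_ zz)|/key/(_ (esym zz))] := wlt_total w w'.
Qed.

(** * Branches of trees of height at most [mu] *)

(* The branches of a tree on the node set [K], given as functions on a
   well-ordered set of levels: a node determines all the nodes below it. *)
Definition tree_system (mu K B : Type) (W : woset) (x : B -> W -> K) : Prop :=
  [/\ cle W mu, forall b b' w v, x b w = x b' w -> v ≺ w -> x b v = x b' v
    & forall b b', (forall w, x b w = x b' w) -> b = b'].

(** [dd K] is not a function of the development: it appears as a type [D] with this property, and
    minimality of [D] is a separate hypothesis where it matters. *)
Definition dd_bound (mu K D : Type) : Prop :=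
  forall (B : Type) (W : woset) (x : B -> W -> K), tree_system mu x -> cle B D.

(** * Branches as points of a linear order with few nodes dense in it *)

Section LexicographicBranches.
Variables (WK W : woset).
Implicit Types (p q : WK * rat) (f g h : W -> WK * rat).

(** The rational component makes the order of labels dense: a well-order alone would leave no label
    strictly between two neighbours. *)
Let plt p q : Prop := p.1 ≺ q.1 \/ p.1 = q.1 /\ (p.2 < q.2)%R.

Local Lemma plt_irr p : ~ plt p p.
Proof. by case=> [/wlt_irr //|[_]]; rewrite Order.POrderTheory.ltxx. Qed.

Local Lemma plt_trans q p r : plt p q -> plt q r -> plt p r.
Proof.
move=> [pq|[pq pq']] [qr|[qr qr']]; [left|left|left|right].
- exact: wlt_trans qr.
- by rewrite -qr.
- by rewrite pq.
- by rewrite pq qr; split=> //; exact: Order.POrderTheory.lt_trans qr'.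
Qed.

Local Lemma plt_total p q : [\/ p = q, plt p q | plt q p].
Proof.
case: p q => [a r] [b s]; have [->|ab|ba] := wlt_total a b;
  [|by constructor 2; left|by constructor 3; left].
case: (Order.TotalTheory.ltgtP r s) => [rs|sr|->].
- by constructor 2; right.
- by constructor 3; right.
- by constructor 1.
Qed.

Local Lemma plt_dense p q : plt p q -> exists2 r, plt p r & plt r q.
Proof.
move=> [pq|[pq pq']].
  exists (p.1, (p.2 + 1)%R); last by left.
  by right; split=> //=; rewrite Num.Theory.ltrDl.
exists (p.1, ((p.2 + q.2) / 2)%R); right; split=> //=.
  by have [] := Num.Theory.midf_lt pq'.
by have [] := Num.Theory.midf_lt pq'.
Qed.

Definition flt f g : Prop := exists2 w, plt (f w) (g w) & forall v, v ≺ w -> f v = g v.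

Lemma flt_irr f : ~ flt f f.
Proof. by move=> [w /plt_irr]. Qed.

Lemma flt_trans g f h : flt f g -> flt g h -> flt f h.
Proof.
move=> [w fg fgE] [u gh ghE]; have [wu|uw|uw] := wlt_total w u.
- subst u; exists w; first exact: plt_trans gh.
  by move=> v vw; rewrite fgE // ghE.
- exists w; first by rewrite -ghE.
  by move=> v vw; rewrite fgE // ghE //; exact: wlt_trans uw.
- exists u; first by rewrite fgE.
  by move=> v vw; rewrite fgE ?ghE //; exact: wlt_trans uw.
Qed.

Lemma flt_total f g : [\/ f = g, flt f g | flt g f].
Proof.
have [->|nfg] := pselect (f = g); first by constructor 1.
have [|nE wm] := @wminP W (fun w => f w <> g w).
  by apply: contrapT => h; apply: nfg; apply/funext => w; apply: contrapT => fg; apply: h; exists w.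
set w := wmin _ in nE wm.
have eqv v : v ≺ w -> f v = g v by move=> vw; apply: contrapT => /wm; apply.
have [//|fg|gf] := plt_total (f w) (g w).
  by constructor 2; exists w.
by constructor 3; exists w => // v /eqv.
Qed.

Variables (mu B : Type) (x : B -> W -> WK).
Hypotheses (Kn : cle nat WK) (muK : cle mu WK) (xT : tree_system mu x).

Let emb (b : B) : W -> WK * rat := fun v => (x b v, 0%R).
Let node (b : B) (w : W) (l : WK * rat) : W -> WK * rat := fun v =>
  if pselect (v ≺ w) then emb b v else if pselect (v = w) then l else (wpt WK, 0%R).
Let is_node (f : W -> WK * rat) : Prop := exists b w l, f = node b w l.
Let I : Type := {f : W -> WK * rat | (exists b, f = emb b) \/ is_node f}.

Local Lemma node_lt b w l v : v ≺ w -> node b w l v = emb b v.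
Proof. by rewrite /node; case: pselect. Qed.

Local Lemma node_eq b w l : node b w l w = l.
Proof.
rewrite /node; case: pselect => [h|h] /=; first by case: (wlt_irr h).
by case: pselect.
Qed.

Local Lemma node_gt b w l v : w ≺ v -> node b w l v = (wpt WK, 0%R).
Proof.
rewrite /node => wv; case: pselect => [h|h] /=; first by case: (wltW h).
by case: pselect => // vw; case: (wlt_neq wv).
Qed.

(** Of two points that first differ at [w], at least one still follows a branch below [w]: two nodes
    that both stopped earlier take the same filler value at [w]. A node placed on this branch, with
    a label in between at [w], separates the points. *)
Local Lemma branch_at (f g : I) w : plt (proj1_sig f w) (proj1_sig g w) ->
  (forall v, v ≺ w -> proj1_sig f v = proj1_sig g v) ->
  exists b, forall v, v ≺ w -> emb b v = proj1_sig f v.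
Proof.
case: f g => [f fP] [g gP] /=.
case: fP gP => [[b ->]|[b [w1 [l1 ->]]]] [[b' ->]|[b' [w2 [l2 ->]]]] fg eqv.
- by exists b.
- by exists b.
- by exists b' => v /eqv ->.
- have [w1w|ww1] := wltP w1 w; last first.
    by exists b => v vw; rewrite node_lt //; exact: wlt_le_trans ww1.
  have [w2w|ww2] := wltP w2 w; last first.
    by exists b' => v vw; rewrite eqv // node_lt //; exact: wlt_le_trans ww2.
  by move: fg; rewrite !node_gt // => /plt_irr.
Qed.

(** By the tree property the level [w], the tree node [x b w] and the label recover the whole
    function, so there are at most [K] nodes. *)
Local Lemma is_node_le : ((fun f : I => is_node (proj1_sig f)) #<= [set: (WK : Type)])%card.
Proof.
have [xW xlow _] := xT.
have [enc enci] : cle (W * WK * (WK * rat)) WK.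
  have WKK : cle (W * WK) WK.
    apply: cle_trans (cle_square Kn); apply: cle_prod (@cle_refl _).
    exact: cle_trans muK.
  have KQ : cle (WK * rat) WK.
    apply: cle_trans (cle_square Kn); apply: cle_prod (@cle_refl _) _.
    by apply: cle_trans Kn; exists (@pickle rat); exact: (pcan_inj pickleK).
  by apply: cle_trans (cle_prod WKK KQ) (cle_square Kn).
pose t0 : W * WK * (WK * rat) := (wpt W, wpt WK, (wpt WK, 0%R)).
pose rep (f : I) (t : W * WK * (WK * rat)) :=
  exists2 b, t.1.2 = x b t.1.1 & proj1_sig f = node b t.1.1 t.2.
pose code (f : I) := epsilon_or t0 (rep f).
have codeP (f : I) : is_node (proj1_sig f) -> rep f (code f).
  move=> [b [w [l fE]]]; apply: epsilon_orP.
  by exists (w, x b w, l); exists b.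
have [h] : $|{injfun (fun f : I => is_node (proj1_sig f)) >-> [set: (WK : Type)]%classic}|.
  apply/injfunPex; exists (enc \o code) => // f g.
  rewrite !inE => fN gN /enci fg; apply: sig_val_inj.
  have [b bE ->] := codeP f fN; have [b' bE' ->] := codeP g gN.
  apply/funext => v; rewrite fg /node.
  case: pselect => // vw; rewrite /emb.
  congr pair; apply: xlow vw; by rewrite -bE' -fg bE.
exact: inj_card_le h.
Qed.

Lemma tree_system_ded : le_cardinal B (ded WK).
Proof.
have Ile : le_cardinal I (ded WK).
  apply: (@ded_ub_rel WK I (fun f g : I => ~ flt (proj1_sig g) (proj1_sig f))
     (fun f : I => is_node (proj1_sig f))); last exact: is_node_le.
  - move=> f g ngf nfg; apply: sig_val_inj.
    by have [//|/nfg|/ngf] := flt_total (proj1_sig f) (proj1_sig g).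
  - move=> f g h ngf nhg hf; apply: ngf.
    have [<-//|/nhg//|gh] := flt_total (proj1_sig h) (proj1_sig g).
    exact: flt_trans gh hf.
  - move=> f g; have [->|fg|gf] := flt_total (proj1_sig f) (proj1_sig g).
    + by left; exact: flt_irr.
    + by left=> /(flt_trans fg)/flt_irr.
    + by right=> /(flt_trans gf)/flt_irr.
  - move=> f g /contrapT[w fg eqv].
    have [b bP] := branch_at fg eqv.
    have [l fl lg] := plt_dense fg.
    have nI : (exists b', node b w l = emb b') \/ is_node (node b w l) by right; exists b, w, l.
    exists (exist _ (node b w l) nI) => /=; first by exists b, w, l.
    split; apply; exists w; rewrite ?node_eq // => v vw; rewrite node_lt // bP //.
    exact: eqv.
apply/cle_le_cardinal; move/cle_le_cardinal: Ile; apply: cle_trans.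
have eI b : (exists b', emb b = emb b') \/ is_node (emb b) by left; exists b.
exists (fun b => exist _ (emb b) (eI b)) => b b' [e].
have [_ _ inj] := xT; apply: inj => w.
by have := congr1 (fun f => (f w).1) e.
Qed.
End LexicographicBranches.

Lemma dd_bound_ded (mu K : Type) : cle nat K -> cle mu K -> dd_bound mu K (ded K).
Proof.
move=> Kn muK B W x xT; apply/cle_le_cardinal.
have [n _] := Kn; have [WK WE] := exists_woset (n 0); subst K.
exact: tree_system_ded xT.
Qed.

Lemma cle_seg_of_segs (W : woset) (w : W) K :
  (forall v, v ≺ w -> ~ cle K (seg v)) -> cle (seg w) K.
Proof.
move=> h; have [[a0 _]|none] := pselect (exists a : seg w, True); last first.
  by exists (fun a => False_rect _ (none (ex_intro _ a Logic.I))) => a; case: none; exists a.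
have pi : injective (@proj1_sig _ (fun u => u ≺ w)) by move=> x y; exact: sig_val_inj.
apply: (@cle_of_segs (wpull a0 pi)) => v Kv; apply: (h (proj1_sig v)); first exact: (proj2_sig v).
apply: cle_trans Kv _.
exists (fun y : @seg (wpull a0 pi) v => exist (fun u => u ≺ proj1_sig v) (proj1_sig (proj1_sig y)) (proj2_sig y)) => y z [].
by move=> /sig_val_inj /sig_val_inj.
Qed.

Definition wunit : woset.
Proof.
refine (@Woset unit tt (fun _ _ => False) _ _ _).
- by [].
- by move=> [] []; apply: Or31.
- by move=> P [x Px]; exists x => // y _ [].
Defined.

Lemma dd_bound_ge (mu K D : Type) : cle nat mu -> dd_bound mu K D -> cle K D.
Proof.
move=> [n _] /(_ K wunit (fun k _ => k)); apply; split=> //.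
- by exists (fun=> n 0) => -[] [].
- by move=> b b'; apply; exact: tt.
Qed.

Lemma dd_bound_mono (mu K K' D : Type) : cle K K' -> dd_bound mu K' D -> dd_bound mu K D.
Proof.
move=> [f fi] h B W x [xW xl xi]; apply: (h B W (fun b w => f (x b w))); split=> //.
- by move=> b b' w v /fi xx vw; congr f; exact: xl vw.
- by move=> b b' xx; apply: xi => w; exact: fi.
Qed.

Lemma tree_system_sub (mu K tau D B : Type) (W : woset) (x : B -> W -> K) (P : K -> Prop) :
  tree_system mu x -> cle {k | P k} tau -> dd_bound mu tau D ->
  cle {b | forall w, P (x b w)} D.
Proof.
move=> [xW xl xi] Pt /(dd_bound_mono Pt) h.
apply: (h _ W (fun (b : {b | forall w, P (x b w)}) w => exist P (x (proj1_sig b) w) (proj2_sig b w))); split=> //.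
- by move=> b b' w v [/xl xx] vw; apply: sig_val_inj; exact: xx.
- by move=> b b' bb; apply: sig_val_inj; apply: xi => w; have [] := bb w.
Qed.

(** Well-order [ded K], add a top so that the whole order is itself a segment, and take the least
    segment that bounds all trees. *)
Lemma exists_dd (mu K : Type) : cle nat mu -> cle mu K -> exists D : Type,
  [/\ dd_bound mu K D, forall D', dd_bound mu K D' -> cle D D' & cle D (ded K)].
Proof.
move=> mun muK; have Kn := cle_trans mun muK; have dK := dd_bound_ded Kn muK.
have [n _] := cle_trans Kn (dd_bound_ge mun dK).
have [W0 WE] := exists_woset (n 0); pose W := wtop W0.
have dN : dd_bound mu K (@seg W None).
  move=> B V x /dK Bd; apply: (cle_trans Bd); rewrite -WE.
  by exists (fun d => exist (fun v => v ≺ (None : W)) (Some d) Logic.I) => d d' [].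
have [|wP wm] := @wminP W (fun w => dd_bound mu K (seg w)); first by exists None.
set w := wmin _ in wP wm.
exists (seg w); split=> // [D' D'P|].
  apply: cle_seg_of_segs => v vw /(fun c => cle_trans (D'P _ _ _ _) c) h.
  apply: (wm v) vw => B V x xT; exact: h xT.
apply: cle_trans (cle_sig _) _; rewrite -WE; apply: cle_option_nat.
by rewrite WE; exact: cle_trans Kn (dd_bound_ge mun dK).
Qed.

Definition wnat : woset.
Proof.
refine (@Woset nat 0 (fun m n => (m < n)%N) _ _ _).
- by move=> m n p; exact: ltn_trans.
- by move=> m n; case: (ltngtP m n); [constructor 2|constructor 3|constructor 1].
- move=> P [n Pn]; have ex : exists n, `[< P n >] by exists n; exact/asboolP.
  exists (ex_minn ex); first by case: ex_minnP => m /asboolP.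
  by move=> m Pm; case: ex_minnP => k _ /(_ m (introT (asboolP _) Pm)); rewrite ltnNge => ->.
Defined.

(** At level [n] the branch holds a code of the first [n+1] terms, which determines the earlier
    codes. Dominating functions are later chosen [nat] many times in succession, and this pays for
    the choices. *)
Lemma cle_pow_nat (mu K D : Type) : cle nat mu -> cle nat K -> dd_bound mu K D -> cle (nat -> K) D.
Proof.
move=> mun Kn; have [k0 _] := Kn; have [p pi] := cle_square Kn.
pose c (b : nat -> K) := fix c n : K := p (if n is m.+1 then c m else k0 0, b n).
have cE b b' n : c b n = c b' n -> b n = b' n /\ forall m, (m < n)%N -> c b m = c b' m.
  elim: n => [|n ih] /= /pi[]; first by [].
  move=> cn bn; split=> // m; rewrite ltnS leq_eqVlt => /orP[/eqP -> //|]; exact: (ih cn).2.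
move=> /(_ _ wnat c); apply; split=> //.
- by move=> b b' w v /cE[_]; apply.
- by move=> b b' cc; apply/funext => n; exact: (cE _ _ _ (cc n)).1.
Qed.

(* The full binary tree of the first height at which it has more than [K] branches. *)
Lemma exists_pow_system (mu K : Type) : cle nat mu -> cle mu K -> ~ cle (mu -> bool) K ->
  exists (B : Type) (W : woset) (x : B -> W -> K), tree_system mu x /\ ~ cle B K.
Proof.
move=> mun muK npow; have Kn := cle_trans mun muK; have [n ni] := mun.
have [Wm WE] := exists_woset (n 0); subst mu; pose W := wtop Wm.
have [|nw wm] := @wminP W (fun w => ~ cle (seg w -> bool) K).
  exists None => h; apply: npow; apply: cle_trans h.
  exists (fun (b : Wm -> bool) (s : @seg W None) => if proj1_sig s is Some m then b m else false) => b b' bb.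
  apply/funext => m; have := congr1 (fun f => f (exist (fun v => v ≺ (None : W)) (Some m) Logic.I)) bb.
  by [].
set w := wmin _ in nw wm.
have [a0 _] : exists a : seg w, True.
  apply: contrapT => none; apply: nw; have [k _] := Kn.
  exists (fun=> k 0) => b b' _; apply/funext => s; by case: none; exists s.
have pi : injective (@proj1_sig _ (fun u => u ≺ w)) by move=> x y; exact: sig_val_inj.
pose V := wpull a0 pi.
have cK (v : V) : cle (seg (proj1_sig v) -> bool) K.
  by apply: contrapT => /wm; apply; exact: (proj2_sig v).
pose c (v : V) := projT1 (cid (cK v)).
have ci v : injective (c v) by rewrite /c; case: cid.
have VM : cle V Wm by apply: cle_trans (cle_sig _) _; exact: cle_option_nat.
have [enc enci] : cle (K * bool * V) K.
  have KB : cle (K * bool) K.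
    apply: cle_trans (cle_square Kn); apply: cle_prod (@cle_refl _) _.
    apply: cle_trans Kn; exists (fun b : bool => if b then 0 else 1); by case=> -[].
  apply: cle_trans (cle_square Kn); apply: cle_prod KB _; exact: cle_trans VM muK.
pose below (v : V) (u : seg (proj1_sig v)) : V :=
  exist (fun u => u ≺ w) (proj1_sig u) (wlt_trans (proj2_sig u) (proj2_sig v)).
(* A node is a partial branch, coded by its restriction below [v], its value at [v], and [v]. The
   minimality of [w] bounds the number of restrictions by [K]. *)
pose x (b : V -> bool) (v : V) := enc (c v (fun u => b (below v u)), b v, v).
have xE b b' v : x b v = x b' v -> b v = b' v /\ forall u : V, u ≺ v -> b u = b' u.
  move=> /enci[/ci bb bv]; split=> // u uv.
  have := congr1 (fun f => f (exist (fun u => u ≺ proj1_sig v) (proj1_sig u) uv)) bb.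
  have -> : below v (exist (fun u => u ≺ proj1_sig v) (proj1_sig u) uv) = u by apply: sig_val_inj.
  by [].
exists (V -> bool), V, x; split=> //; split=> //.
  move=> b b' v u /xE[_ bb] uv; rewrite /x (bb _ uv).
  have -> // : (fun s => b (below u s)) = (fun s => b' (below u s)).
  apply/funext => s; apply: bb; apply: wlt_trans uv; exact: (proj2_sig s).
by move=> b b' xx; apply/funext => v; exact: (xE _ _ _ (xx v)).1.
Qed.

(** * Covering numbers *)

(** In pcf notation: the covering number [cov(A, tau^+, mu^+, 2)] is at most [Q]. *)
Definition cov (mu A tau Q : Type) : Prop := exists P : Q -> A -> Prop,
  (forall q, cle {a | P q a} tau) /\ forall x : mu -> A, exists q, forall i, P q (x i).

Lemma cle_levels (mu : Type) (W : woset) : cle W mu -> exists e : mu -> W, forall w, exists i, e i = w.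
Proof. exact: cle_reindex id (wpt W). Qed.

Lemma cov_pow (mu Q tau : Type) : cle nat mu -> cle mu Q ->
  cov mu Q tau Q -> dd_bound mu tau Q -> cle (mu -> bool) Q.
Proof.
move=> mun muQ [P [Pt Pc]] dQ; apply: contrapT => /(exists_pow_system mun muQ)[B [W [x [xT]]]].
apply; apply: cle_trans (cle_square (cle_trans mun muQ)).
have [xW _ _] := xT; have [e eP] := cle_levels xW.
apply: (@cle_bigcup Q B Q (fun q b => forall w, P q (x b w))) => [b|q].
  by have [q qP] := Pc (fun i => x b (e i)); exists q => w; have [i <-] := eP w.
exact: tree_system_sub xT (Pt q) dQ.
Qed.

Lemma cle_option_mono A B : cle A B -> cle (option A) (option B).
Proof. by move=> [f fi]; exists (omap f) => -[a|] [b|] //= [/fi ->]. Qed.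

(** A point of [A'] is named by a branch through [A], hence by [mu] points of [A]; a family of [mu]
    points of [A'] thus becomes a family of [mu * mu] points of [A]. A covering set of size [tau]
    contains at most [tau'] names. *)
Lemma cov_dd (mu A tau Q A' tau' : Type) : cle nat mu -> cle mu A -> cle mu tau -> cle A' Q ->
  dd_bound mu A A' -> (forall D, dd_bound mu A D -> cle A' D) -> dd_bound mu tau tau' ->
  cov mu A tau Q -> cov mu A' tau' Q.
Proof.
move=> mun muA mut A'Q dA' dmin dt [P [Pt Pc]].
have AA' := dd_bound_ge mun dA'; have tt' := dd_bound_ge mun dt.
have A'n : cle nat A' := cle_trans mun (cle_trans muA AA').
have t'n : cle nat tau' := cle_trans mun (cle_trans mut tt').
have [pr prP] : exists pr : mu -> mu * mu, forall p, exists i, pr i = p.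
  by have [n _] := mun; apply: cle_reindex id (n 0, n 0) (cle_square mun).
have [n _] := A'n; have [W [WE Wi]] := exists_initial_woset (n 0).
have [N NP] : exists N : W -> W -> mu -> A, forall z (Y : A -> Prop), cle {y | Y y} tau ->
    cle {a : W | a ≺ z /\ forall i, Y (N z a i)} tau'.
  apply: (@fun_choice W (W -> mu -> A) (fun z N => forall (Y : A -> Prop), cle {y | Y y} tau ->
    cle {a : W | a ≺ z /\ forall i, Y (N a i)} tau')) => z.
  (* The supremum [A'] may not be attained, so names are given below each [z] separately: [seg z] is
     smaller than [A'] and is beaten by some tree. *)
  have [B [V [x [xT nB]]]] : exists (B : Type) (V : woset) (x : B -> V -> A), tree_system mu x /\ ~ cle B (seg z).
    apply: contrapT => h; apply: (Wi z); rewrite WE; apply: dmin => B V x xT.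
    by apply: contrapT => nB; apply: h; exists B, V, x.
  have [f fi] := not_cle nB; have [xW _ _] := xT; have [e eP] := cle_levels xW.
  have [a0 _] : exists a : A, True by have [k _] := cle_trans mun muA; exists (k 0).
  exists (fun a i => if pselect (a ≺ z) is left h then x (f (exist _ a h)) (e i) else a0) => Y Yt.
  apply: cle_trans (tree_system_sub xT Yt dt).
  have bP (a : {a : W | a ≺ z /\ forall i, Y (if pselect (a ≺ z) is left h then x (f (exist _ a h)) (e i) else a0)}) :
      exists b : {b | forall w, Y (x b w)}, exists h, proj1_sig b = f (exist _ (proj1_sig a) h).
    case: a => a [az aY] /=.
    have bY w : Y (x (f (exist _ a az)) w).
      have [i <-] := eP w; have := aY i; case: pselect => // h.
      by rewrite (Prop_irrelevance h az).
    by exists (exist _ _ bY), az.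
  have [b bE] := fun_choice bP; exists b => a a' bb; apply: sig_val_inj.
  have [h hE] := bE a; have [h' hE'] := bE a'.
  by move: hE'; rewrite -bb hE => /fi[].
subst A'.
(* If [mu] many segments exhaust [A'], their namings are glued, and a covering set only grows by a
   factor [mu]. *)
have [[z zc]|nz] := pselect (exists z : mu -> W, forall a, exists i, a ≺ z i).
  have [i iP] := fun_choice zc.
  exists (fun q a => forall j, P q (N (z (i a)) a j)); split=> [q|x].
    apply: (cle_trans (B := mu * tau')); last first.
      apply: cle_trans (cle_square t'n); apply: cle_prod (@cle_refl _).
      exact: cle_trans mut tt'.
    apply: (@cle_bigcup mu _ tau' (fun m (a : {a | forall j, P q (N (z (i a)) a j)}) => i (proj1_sig a) = m)) => [a|m].
      by exists (i (proj1_sig a)).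
    apply: cle_trans (NP (z m) (P q) (Pt q)).
    have aP (a : {a : {a | forall j, P q (N (z (i a)) a j)} | i (proj1_sig a) = m}) :
        proj1_sig (proj1_sig a) ≺ z m /\ forall j, P q (N (z m) (proj1_sig (proj1_sig a)) j).
      by case: a => -[a aP] /= <-; split.
    exists (fun a => exist (fun a => a ≺ z m /\ forall j, P q (N (z m) a j)) _ (aP a)) => a a' [aa].
    by apply: sig_val_inj; apply: sig_val_inj.
  have [q qP] := Pc (fun m => N (z (i (x (pr m).1))) (x (pr m).1) (pr m).2).
  by exists q => m j; have [k kE] := prP (m, j); have := qP k; rewrite kE.
have Qn : cle nat Q := cle_trans A'n A'Q.
have [pQ pQP] : exists pQ : Q -> W * Q, forall p, exists q, pQ q = p.
  have [k _] := Qn; apply: cle_reindex id (wpt W, k 0) _.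
  by apply: cle_trans (cle_square Qn); exact: cle_prod (@cle_refl _).
(* Otherwise each family has a bound [z], which becomes part of the index. The bound is weak, hence
   the extra point [z] itself. *)
exists (fun q a => a = (pQ q).1 \/ a ≺ (pQ q).1 /\ forall j, P (pQ q).2 (N (pQ q).1 a j)); split=> [q|x].
  apply: cle_trans (cle_option_nat t'n).
  apply: cle_trans (cle_option_mono (NP (pQ q).1 (P (pQ q).2) (Pt _))).
  pose S := {a | a = (pQ q).1 \/ a ≺ (pQ q).1 /\ forall j, P (pQ q).2 (N (pQ q).1 a j)}.
  have sP (s : S) : exists o : option {a : W | a ≺ (pQ q).1 /\ forall i, P (pQ q).2 (N (pQ q).1 a i)},
      if o is Some a then proj1_sig a = proj1_sig s else proj1_sig s = (pQ q).1.
    by case: s => a [aE|aP]; [exists None|exists (Some (exist _ a aP))].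
  have [f fP] := fun_choice sP; exists f => s s' ff; apply: sig_val_inj.
  by have := fP s; have := fP s'; rewrite -ff; case: (f s) => [a <- <-|-> ->].
have [z zP] : exists z : W, forall i, x i ≼ z.
  apply: contrapT => h; apply: nz; exists x => a.
  by apply: contrapT => k; apply: h; exists a => i ai; apply: k; exists i.
have [q qP] := Pc (fun m => N z (x (pr m).1) (pr m).2).
have [k kE] := pQP (z, q); exists k => i; rewrite kE /=.
have [->|xz] := wle_eqVlt (zP i); [by left|right; split=> // j].
by have [m mE] := prP (i, j); have := qP m; rewrite mE.
Qed.

(** * Products of ordinals captured by few functions *)

Section Good.
Variables (mu : Type) (V O : woset) (T : Type).
Hypotheses (mun : cle nat mu) (sV : wsucc mu V) (VT : cle V T).
Local Notation F := (mu -> O).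
Implicit Types (M E : mu -> Prop) (c : mu -> O) (Phi : (F -> Prop) -> F) (g : V -> F).

Definition below M c (f : F) : Prop := forall m, M m -> f m ≺ c m.
Definition bigcof M c : Prop := forall m, M m -> cofgt T (c m).
Definition chain M c g : Prop := (forall w, below M c (g w)) /\
  forall v w, v ≺ w -> forall m, M m -> g v m ≺ g w m.
Definition between g (w0 w : V) : F -> Prop := fun f => exists v, [/\ w0 ≼ v, v ≺ w & g v = f].
(** The history starts at [w0], so a strategy can be launched in the middle of a chain, ignorant of
    what came before. Only a lower bound is imposed, so strategies are combined by taking
    suprema. *)
Definition obeys M Phi g (w0 : V) : Prop :=
  forall w, w0 ≺ w -> forall m, M m -> Phi (between g w0 w) m ≼ g w m.
Definition outcome M g (o : F) : Prop := forall m, M m ->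
  (forall w, g w m ≼ o m) /\ forall x, x ≺ o m -> exists w, x ≺ g w m.
Definition small (A : F -> Prop) : Prop := exists e : mu -> F, forall f, A f -> exists i, e i = f.
Definition valid M c Phi : Prop :=
  forall A, small A -> (forall f, A f -> below M c f) -> below M c (Phi A).

(* A strategy [Phi] such that the supremum of any increasing chain of length
   [mu^+] that follows it from some point on is, on [E], one of [K] functions. *)
Definition good M c (K : Type) E : Prop := exists (H : K -> F) Phi, valid M c Phi /\
  forall g w0 o, chain M c g -> obeys M Phi g w0 -> outcome M g o ->
    exists k, forall m, M m -> E m -> H k m = o m.

Local Lemma muT : cle mu T.
Proof. exact: cle_trans (wsucc_cle sV) VT. Qed.

Local Lemma Tn : cle nat T.
Proof. exact: cle_trans mun muT. Qed.

Definition psup (S : F -> Prop) : F := fun m => wlub (fun x => exists2 f, S f & f m = x).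

Definition Tsmall (S : F -> Prop) : Prop := exists e : T -> F, forall f, S f -> exists i, e i = f.

Lemma TsmallI (I : Type) (e : I -> F) (S : F -> Prop) :
  cle I T -> (forall f, S f -> exists i, e i = f) -> Tsmall S.
Proof.
move=> /(cle_reindex e (fun=> wpt O))[k kP] h; exists k => f /h[i <-]; exact: kP.
Qed.

Lemma between_small g w0 w : small (between g w0 w).
Proof.
have [e eP] := wsucc_enum sV w.
by exists (fun i => g (e i)) => _ [v [_ /eP[i <-] <-]]; exists i.
Qed.

Lemma psup_bound M c S : bigcof M c -> Tsmall S -> (forall f, S f -> below M c f) ->
  forall m, M m -> exists2 x, x ≺ c m & forall f, S f -> f m ≺ x.
Proof.
move=> cT [e eP] Sb m Mm; have [[x0 x0c] ct] := cT m Mm.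
have [|x xc xP] := ct (fun t => if pselect (S (e t)) then e t m else x0).
  by move=> t; case: pselect => //= h; exact: Sb.
exists x => // f Sf; have [t te] := eP _ Sf; have := xP t.
by case: pselect => /=; rewrite te.
Qed.

Lemma psup_below M c S : bigcof M c -> Tsmall S -> (forall f, S f -> below M c f) ->
  below M c (psup S).
Proof.
move=> cT St Sb m Mm; have [x xc xP] := psup_bound cT St Sb Mm.
by apply: wle_lt_trans xc; apply: wlub_least => _ [f Sf <-]; exact/wltW/xP.
Qed.

Lemma psup_ub M c S f m : bigcof M c -> Tsmall S -> (forall f, S f -> below M c f) ->
  S f -> M m -> f m ≼ psup S m.
Proof.
move=> cT St Sb Sf Mm; have [x xc xP] := psup_bound cT St Sb Mm.
apply: (@wlub_ub _ _ x); last by exists f.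
by move=> _ [h Sh <-]; exact/wltW/xP.
Qed.

Lemma below_next M c f : bigcof M c -> below M c f ->
  exists2 y, below M c y & forall m, M m -> f m ≺ y m.
Proof.
move=> cT fb.
have [y yP] : exists y : F, forall m, M m -> f m ≺ y m /\ y m ≺ c m.
  apply: (@fun_choice mu O (fun m z => M m -> f m ≺ z /\ z ≺ c m)) => m.
  have [Mm|nM] := pselect (M m); last by exists (wpt O).
  by have [z ? ?] := cofgt_next Tn (cT m Mm) (fb m Mm); exists z.
by exists y => m /yP[].
Qed.

Lemma below_bot M c : bigcof M c -> below M c (fun=> wbot O).
Proof. by move=> cT m /cT[[x xc] _]; apply: wle_lt_trans xc; exact: wbot_le. Qed.

Lemma between_ext g g' w0 w : (forall v, v ≺ w -> g v = g' v) -> between g w0 w = between g' w0 w.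
Proof.
move=> gg; apply/funext => f; apply/propext; split=> -[v [? vw <-]]; exists v; split=> //.
  by rewrite gg.
by rewrite gg.
Qed.

Lemma exists_chain M c Phi p : bigcof M c -> valid M c Phi -> below M c p ->
  exists g, [/\ chain M c g, obeys M Phi g (wbot V) & forall w m, M m -> p m ≼ g w m].
Proof.
move=> cT vP pb.
have [||g gP] := @wrec V F p (fun w g y => (forall v, v ≺ w -> below M c (g v)) ->
    [/\ below M c y, forall m, M m -> p m ≼ y m, forall v, v ≺ w -> forall m, M m -> g v m ≺ y m
      & forall m, M m -> Phi (between g (wbot V) w) m ≼ y m]).
- move=> w g g' y gg h b; have [|h1 h2 h3 h4] := h.
    by move=> v vw; rewrite gg //; exact: b.
  split=> // [v vw|]; first by rewrite -gg //; exact: h3.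
  by rewrite -(between_ext _ gg).
- move=> w g _; have [b|nb] := pselect (forall v, v ≺ w -> below M c (g v)); last by exists p.
  pose S (f : F) := (between g (wbot V) w f \/ f = p) \/ f = Phi (between g (wbot V) w).
  have [e eP] := between_small g (wbot V) w.
  have bb f : between g (wbot V) w f -> below M c f by move=> [v [_ /b + <-]].
  have Sb f : S f -> below M c f.
    by move=> [[/bb //|->//]|->]; apply: vP => //; exact: between_small.
  have St : Tsmall S.
    apply: (@TsmallI (mu * nat)%type (fun i => if i.2 is 0 then e i.1 else if i.2 is 1 then p else Phi (between g (wbot V) w))).
      apply: cle_trans muT; apply: cle_trans (cle_square mun); exact: cle_prod (@cle_refl _) _.
    have [n _] := mun.
    by move=> f [[/eP[i <-]|->]|->]; [exists (i, 0)|exists (n 0, 1)|exists (n 0, 2)].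
  have [y yb yP] := below_next cT (psup_below cT St Sb).
  have ub f m : S f -> M m -> f m ≺ y m.
    by move=> Sf Mm; apply: wle_lt_trans (yP m Mm); exact: psup_ub St Sb Sf Mm.
  exists y => _; split=> // [m Mm|v vw m Mm|m Mm].
  + by apply: wltW; apply: ub => //; left; right.
  + by apply: ub => //; left; left; exists v; split=> //; exact: wbot_le.
  + by apply: wltW; apply: ub => //; right.
have gb : forall w, below M c (g w).
  by elim/wind=> w ih; have [] := gP w ih.
exists g; split=> [|w _|w].
- by split=> // v w vw; have [_ _ h _] := gP w (fun v _ => gb v); exact: h.
- by have [_ _ _] := gP w (fun v _ => gb v).
- by have [_ h _ _] := gP w (fun v _ => gb v).
Qed.

Lemma chain_outcome M c g : bigcof M c -> chain M c g ->
  exists2 o, outcome M g o & below M c o.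
Proof.
move=> cT [gb gm]; pose S f := exists w, g w = f.
have St : Tsmall S by exact: (@TsmallI V g).
have Sb f : S f -> below M c f by move=> [w <-].
exists (psup S); last exact: psup_below.
move=> m Mm; split=> [w|x /wlub_lt[_ [_ [w <-] <-] xw]]; last by exists w.
by apply: (psup_ub cT St Sb) Mm; exists w.
Qed.

(** Start a chain above [h] and obey the strategy: its supremum dominates [h], is one of [K]
    functions, and stays below [c] because the cofinalities exceed the length of the chain. *)
Lemma good_dom M c K : bigcof M c -> good M c K M -> exists G : K -> F,
  forall h, below M c h -> exists k, forall m, M m -> h m ≼ G k m /\ G k m ≺ c m.
Proof.
move=> cT [H [Phi [vP HP]]]; exists H => h hb.
have [g [gc go hg]] := exists_chain cT vP hb.
have [o oP ob] := chain_outcome cT gc.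
have [k kP] := HP g _ o gc go oP; exists k => m Mm; rewrite kP //; split; last exact: ob.
apply: (wle_trans (hg (wbot V) m Mm)); exact: (oP m Mm).1.
Qed.

Lemma good_sub M c K E E' : (forall m, M m -> E m -> E' m) -> good M c K E' -> good M c K E.
Proof.
move=> EE [H [Phi [vP HP]]]; exists H, Phi; split=> // g w0 o gc go oP.
by have [k kP] := HP g w0 o gc go oP; exists k => m Mm /(EE m Mm); exact: kP.
Qed.

Lemma good_cle M c K K' E : cle K K' -> good M c K E -> good M c K' E.
Proof.
move=> KK [H [Phi [vP HP]]]; have [H' H'P] := cle_reindex H (fun=> wpt O) KK.
exists H', Phi; split=> // g w0 o gc go oP.
by have [k kP] := HP g w0 o gc go oP; have [k' kE] := H'P k; exists k'; rewrite kE.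
Qed.

Lemma good_empty M c K E : bigcof M c -> cle nat K -> (forall m, M m -> ~ E m) -> good M c K E.
Proof.
move=> cT [k _] nE; exists (fun _ _ => wbot O), (fun _ _ => wbot O); split.
  by move=> A _ _; exact: below_bot.
by move=> g w0 o _ _ _; exists (k 0) => m Mm /(nE m Mm).
Qed.

Lemma good_union M c K E E' : cle nat K -> good M c K E -> good M c K E' ->
  good M c K (fun m => E m \/ E' m).
Proof.
move=> Kn [H [Phi [vP HP]]] [H' [Phi' [vP' HP']]].
have [G GP] := cle_reindex (fun (p : K * K) m => if pselect (E m) then H p.1 m else H' p.2 m)
  (fun=> wpt O) (cle_square Kn).
exists G, (fun A m => wmax (Phi A m) (Phi' A m)); split.
  by move=> A sA Ab m Mm; apply: wmax_lt; [exact: vP|exact: vP'].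
move=> g w0 o gc go oP.
have [|k kP] := HP g w0 o gc _ oP.
  by move=> w ww m Mm; apply: wle_trans (go w ww m Mm); exact: wmax_l.
have [|k' kP'] := HP' g w0 o gc _ oP.
  by move=> w ww m Mm; apply: wle_trans (go w ww m Mm); exact: wmax_r.
have [j jE] := GP (k, k'); exists j => m Mm; rewrite jE /=.
by case: pselect => /= [Em _|nE [//|E'm]]; [exact: kP|exact: kP'].
Qed.

Lemma good_widen M M' c K E : bigcof M' c -> (forall m, M m -> M' m) -> (forall m, E m -> M m) ->
  good M c K E -> good M' c K E.
Proof.
move=> cT MM EM [H [Phi [vP HP]]].
exists H, (fun A m => if pselect (M m) then Phi A m else wbot O); split.
  move=> A sA Ab m Mm'; case: pselect => /= [Mm|_]; last exact: (below_bot cT).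
  by apply: vP => // f Af k Mk; apply: Ab => //; exact: MM.
move=> g w0 o [gb gm] go oP.
have [||| k kP] := HP g w0 o.
- by split=> [w m /MM|v w vw m /MM]; [exact: gb|exact: gm].
- by move=> w ww m Mm; have := go w ww m (MM _ Mm); case: pselect.
- by move=> m /MM; exact: oP.
by exists k => m _ Em; apply: kP => //; exact: EM.
Qed.

Lemma chain_le M c g v w m : chain M c g -> v ≼ w -> M m -> g v m ≼ g w m.
Proof. by move=> [_ gm] /wle_eqVlt[->|vw] Mm; [exact: wle_refl|exact/wltW/gm]. Qed.

(* Following each other's coordinates makes the supremum constant. *)
Lemma good_const M c K (nu : O) : bigcof M c -> cle O K ->
  good M c K (fun m => c m = nu).
Proof.
move=> cT OK; have [H HP] := cle_reindex (fun (x : O) (_ : mu) => x) (fun=> wpt O) OK.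
pose S (A : F -> Prop) (f : F) := exists h m', [/\ A h, M m', c m' = nu & f = fun=> h m'].
exists H, (fun A m => if pselect (c m = nu) then psup (S A) m else wbot O); split.
  move=> A [e eP] Ab m Mm; case: pselect => /= [cm|_]; last exact: (below_bot cT Mm).
  apply: (@psup_below (fun m => M m /\ c m = nu) c) => //.
  - by move=> k [/cT].
  - apply: (@TsmallI (mu * mu)%type (fun p _ => e p.1 p.2)).
      exact: cle_trans (cle_square mun) muT.
    by move=> f [h [m' [/eP[i <-] _ _ ->]]]; exists (i, m').
  - by move=> f [h [m' [Ah Mm' cm' ->]]] k [_ ck]; rewrite ck -cm'; exact: Ab.
move=> g w0 o gc go oP.
have key m m' : M m -> M m' -> c m = nu -> c m' = nu -> o m ≼ o m'.
  move=> Mm Mm' cm cm' lt; have [v lt'] := (oP m Mm).2 _ lt.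
  have [w vw ww] : exists2 w, v ≺ w & w0 ≺ w.
    have [w wP] := wsucc_omega mun sV (fun n => if n is 0 then v else w0).
    by exists w; [exact: (wP 0)|exact: (wP 1)].
  have [w' ww'] := wsucc_nolast mun sV w.
  have := go w' (wlt_trans ww ww') m' Mm'; case: pselect => //= _ le.
  have le2 : g w m ≼ psup (S (between g w0 w')) m'.
    have [e eP] := between_small g w0 w'.
    apply: (@psup_ub (fun m => M m /\ c m = nu) c _ (fun=> g w m)) => //.
    - by move=> k [/cT].
    - apply: (@TsmallI (mu * mu)%type (fun p _ => e p.1 p.2)).
        exact: cle_trans (cle_square mun) muT.
      by move=> f [h [k [/eP[i <-] _ _ ->]]]; exists (i, k).
    - move=> f [h [k [[u [_ _ <-]] Mk ck ->]]] l [_ cl]; rewrite cl -ck; exact: gc.1.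
    - by exists (g w), m; split=> //; exists w; split=> //; exact: wltW.
  have := gc.2 _ _ vw _ Mm => gvw.
  have h1 := wlt_le_trans (wlt_trans lt' gvw) (wle_trans le2 le).
  exact: ((oP m' Mm').1 w') h1.
have [[m0 [Mm0 cm0]]|none] := pselect (exists m, M m /\ c m = nu); last first.
  have [k _] := HP (wpt O); exists k => m Mm cm; by case: none; exists m.
have [k kE] := HP (o m0); exists k => m Mm cm; rewrite kE.
by apply: wle_anti; exact: key.
Qed.

Lemma good_chain M c K D (J : woset) (E : J -> mu -> Prop) : bigcof M c -> cle nat K ->
  cle J mu -> dd_bound mu K D -> (forall i j, i ≺ j -> forall m, E i m -> E j m) ->
  (forall j, good M c K (E j)) -> good M c D (fun m => exists j, E j m).
Proof.
move=> cT [k0 _] Jmu KD Einc /(fun h => fun_choice h)[H] /(fun h => fun_choice h)[P PP].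
pose S A f := exists j, P j A = f.
have St A : Tsmall (S A) by apply: (@TsmallI J (fun j => P j A)) => //; exact: cle_trans muT.
pose Phi A := psup (S A).
have Sb A : small A -> (forall f, A f -> below M c f) -> forall f, S A f -> below M c f.
  by move=> sA Ab f [j <-]; exact: (PP j).1.
(* The suprema, set to bottom off the union of the [E j], so that such a function is determined by
   its restrictions to the [E j]. *)
pose B := {b : F | exists g w0 o, [/\ chain M c g, obeys M Phi g w0, outcome M g o,
  forall m, M m -> (exists j, E j m) -> b m = o m & forall m, ~ (M m /\ exists j, E j m) -> b m = wbot O]}.
(* The chosen code depends only on [b] restricted to [E j]. Equal codes at [j] mean equal
   restrictions, hence equal codes at all lower levels: the tree property. *)
pose x (b : B) (j : J) : K := epsilon_or (k0 0) (fun k => forall m, M m -> E j m -> H j k m = proj1_sig b m).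
have bet g w0 w : chain M c g -> forall f, between g w0 w f -> below M c f.
  by move=> gc f [v [_ _ <-]]; exact: gc.1.
have captured g w0 o j : chain M c g -> obeys M Phi g w0 -> outcome M g o ->
    exists k, forall m, M m -> E j m -> H j k m = o m.
  move=> gc go oP; apply: ((PP j).2 g w0 o gc _ oP) => w ww m Mm.
  have SbA := Sb _ (between_small g w0 w) (bet g w0 w gc).
  have Sj : S (between g w0 w) (P j (between g w0 w)) by exists j.
  exact: wle_trans (psup_ub cT (St _) SbA Sj Mm) (go w ww m Mm).
have xP b j : forall m, M m -> E j m -> H j (x b j) m = proj1_sig b m.
  apply: (@epsilon_orP K (k0 0) (fun k => forall m, M m -> E j m -> H j k m = proj1_sig b m)).
  case: b => b [g [w0 [o [gc go oP bo _]]]] /=.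
  have [k kP] := captured g w0 o j gc go oP.
  by exists k => m Mm Em; rewrite kP // bo //; exists j.
have BD : cle B D.
  apply: (KD B J x); split=> //.
  - move=> b b' j i xx ij; rewrite /x; congr epsilon_or; apply/funext => k; apply/propext.
    have bb m : M m -> E i m -> proj1_sig b m = proj1_sig b' m.
      by move=> Mm /(Einc _ _ ij) Em; rewrite -(xP b j) // xx xP.
    by split=> h m Mm Em; rewrite h // bb.
  - move=> b b' xx; apply: sig_val_inj; apply/funext => m.
    have [[Mm [j Em]]|nm] := pselect (M m /\ exists j, E j m).
      by rewrite -(xP b j) // xx xP.
    case: b b' {xx} => b [g [w0 [o [_ _ _ _ bn]]]] [b' [g' [w0' [o' [_ _ _ _ bn']]]]] /=.
    by rewrite bn // bn'.
have [G GP] := cle_reindex (@proj1_sig _ _ : B -> F) (fun=> wpt O) BD.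
exists G, Phi; split=> [A sA Ab|g w0 o gc go oP].
  by apply: psup_below => //; exact: Sb.
pose b m := if pselect (M m /\ exists j, E j m) then o m else wbot O.
have bP : exists g w0 o, [/\ chain M c g, obeys M Phi g w0, outcome M g o,
  forall m, M m -> (exists j, E j m) -> b m = o m & forall m, ~ (M m /\ exists j, E j m) -> b m = wbot O].
  exists g, w0, o; split=> // m.
    by move=> Mm Em; rewrite /b; case: pselect => //= -[]; split.
  by rewrite /b; case: pselect.
have [k kE] := GP (exist _ b bP); exists k => m Mm Em; rewrite kE /= /b.
by case: pselect => //= -[]; split.
Qed.

(** * Sets of coordinates on which a scale is cofinal are good *)

Section Scale.
Variables (M : mu -> Prop) (c : mu -> O) (K : Type) (a : O) (f : O -> F) (r : F) (a0 : O).
Hypotheses (cT : bigcof M c) (OK : cle O K) (Kn : cle nat K).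
Hypothesis fb : forall b, b ≺ a -> below M c (f b).
Hypothesis finc : forall b' b, b' ≺ b -> b ≺ a -> good M c K (fun m => f b m ≺ f b' m).
Hypotheses (acof : cofgt V a) (a0a : a0 ≺ a).
Hypothesis scale : forall h, below M c h -> exists b,
  [/\ a0 ≼ b, b ≺ a & forall m, M m -> r m ≺ f b m -> h m ≺ f b m].
Hypothesis notgood : ~ good M c K (fun m => r m ≺ f a0 m).

Let ok (h : F) (b : O) := [/\ a0 ≼ b, b ≺ a & forall m, M m -> r m ≺ f b m -> h m ≺ f b m].
Let al (h : F) : O := wmin (ok h).

Local Lemma alP h : below M c h -> ok h (al h).
Proof. by move=> /scale[b bP]; have [|] := @wminP O (ok h); first by exists b. Qed.

Local Lemma al_mono h h' : below M c h' -> (forall m, M m -> h m ≼ h' m) -> al h ≼ al h'.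
Proof.
move=> /alP[h1 h2 h3] le; have [|_ mn] := @wminP O (ok h); last apply: mn.
- by exists (al h'); split=> // m Mm /(h3 m Mm); exact: wle_lt_trans (le m Mm).
- by split=> // m Mm /(h3 m Mm); exact: wle_lt_trans (le m Mm).
Qed.

(** If [f b] stayed below [r], the set where [r ≺ f a0] would be contained in the one where
    [f b ≺ f a0], which is good. *)
Local Lemma above_r b : a0 ≼ b -> b ≺ a -> exists2 m, M m & r m ≺ f b m.
Proof.
move=> ab ba; apply: contrapT => h; apply: notgood.
have {}h m : M m -> f b m ≼ r m by move=> Mm lt; apply: h; exists m.
have [ab'|{}ab] := wle_eqVlt ab.
  by apply: good_empty => // m Mm; rewrite ab'; exact: h.
apply: good_sub (finc ab ba) => m Mm; exact: wle_lt_trans (h m Mm).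
Qed.

(** The coordinates at which the scale fails to increase along [a0], [p.1], [p.2]; there are only
    good many of them. *)
Let Gs (p : O * O) (m : mu) : Prop := f p.2 m ≺ f p.1 m \/ f p.1 m ≺ f a0 m.
Let okp (p : O * O) : Prop := [/\ a0 ≼ p.1, p.1 ≼ p.2 & p.2 ≺ a].

Local Lemma Gs_good p : okp p -> good M c K (Gs p).
Proof.
have le b b' : b' ≼ b -> b ≺ a -> good M c K (fun m => f b m ≺ f b' m).
  move=> /wle_eqVlt[->|bb ba]; last exact: finc.
  by move=> _; apply: good_empty => // m _; exact: wlt_irr.
move=> [ap pp pa]; apply: good_union => //; first exact: le.
by apply: le => //; exact: wle_lt_trans pa.
Qed.

Let be (A : F -> Prop) : O := wlub (fun x => exists2 h, A h & al h = x).

Local Lemma al_bound A : small A -> (forall h, A h -> below M c h) ->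
  exists2 b, b ≺ a & forall h, A h -> al h ≺ b.
Proof.
move=> [e eP] Ab; have [_ cf] := cofgt_cle (wsucc_cle sV) acof.
have [|b ba bP] := cf (fun i => if pselect (A (e i)) then al (e i) else a0).
  by move=> i; case: pselect => //= h; have [] := alP (Ab _ h).
exists b => // h Ah; have [i ie] := eP _ Ah; have := bP i.
by case: pselect => /=; rewrite ie.
Qed.

Local Lemma be_ub A h : small A -> (forall h, A h -> below M c h) -> A h -> al h ≼ be A.
Proof.
move=> sA Ab Ah; have [b _ bP] := al_bound sA Ab.
by apply: (@wlub_ub _ _ b); [move=> _ [k Ak <-]; exact/wltW/bP|exists h].
Qed.

Local Lemma be_lt A : small A -> (forall h, A h -> below M c h) -> be A ≺ a.
Proof.
move=> sA Ab; have [b ba bP] := al_bound sA Ab.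
by apply: wle_lt_trans ba; apply: wlub_least => _ [k Ak <-]; exact/wltW/bP.
Qed.

Variable HP : O * O -> (K -> F) * ((F -> Prop) -> F).
Hypothesis HPP : forall p, okp p -> valid M c (HP p).2 /\
  forall g w0 o, chain M c g -> obeys M (HP p).2 g w0 -> outcome M g o ->
    exists k, forall m, M m -> Gs p m -> (HP p).1 k m = o m.

(** A strategy sees only a set of earlier values. On a chain, comparison with the member [g t] cuts
    this set into the history before [t] and the history from [t] on, so that another strategy can
    be launched at [t]. *)
Let A_ge (h0 : F) (A : F -> Prop) h := A h /\ forall m, M m -> h0 m ≼ h m.
Let A_lt (h1 : F) (A : F -> Prop) h := A h /\ forall m, M m -> h m ≺ h1 m.

(** The first demand makes the position [al] strictly increase along the chain. The second keeps the
    scale at a limit position below all later values. The third launches the strategies of all sets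
    [Gs] that may matter, at all possible starting points, since the relevant one is known only at
    the end. *)
Let Dem (A : F -> Prop) (y : F) : Prop :=
  [\/ exists2 h, A h & y = f (al h), y = f (be A)
    | exists h0 h h1, [/\ [/\ A h0, A h & A h1], okp (al h, be (A_lt h1 A))
        & y = (HP (al h, be (A_lt h1 A))).2 (A_ge h0 A)]].

Let Phi (A : F -> Prop) : F := psup (Dem A).

Local Lemma Dem_small A : small A -> Tsmall (Dem A).
Proof.
move=> [e eP].
apply: (@TsmallI (mu * (mu * (mu * nat)))%type (fun i =>
  if i.2.2.2 is 0 then f (al (e i.1)) else if i.2.2.2 is 1 then f (be A) else
  (HP (al (e i.2.1), be (A_lt (e i.2.2.1) A))).2 (A_ge (e i.1) A))).
  apply: cle_trans muT.
  have sq (X : Type) : cle X mu -> cle (mu * X) mu.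
    by move=> Xm; apply: cle_trans (cle_square mun); exact: cle_prod (@cle_refl _) Xm.
  by apply/sq/sq/sq.
have [n _] := mun.
move=> y [[h /eP[i <-] ->]|->|[h0 [h [h1 [[/eP[i <-] /eP[j <-] /eP[k <-]] _ ->]]]]].
- by exists (i, (i, (i, 0))).
- by exists (n 0, (n 0, (n 0, 1))).
- by exists (i, (j, (k, 2))).
Qed.

Local Lemma Dem_below A : small A -> (forall h, A h -> below M c h) ->
  forall y, Dem A y -> below M c y.
Proof.
move=> sA Ab y [[h Ah ->]|->|[h0 [h [h1 [_ okk ->]]]]].
- by apply: fb; have [] := alP (Ab _ Ah).
- by apply: fb; exact: be_lt.
- apply: (HPP okk).1 => [|k [/Ab //]].
  by have [e eP] := sA; exists e => k [/eP].
Qed.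

Local Lemma between_below g w0 w : chain M c g -> forall h, between g w0 w h -> below M c h.
Proof. by move=> gc h [v [_ _ <-]]; exact: gc.1. Qed.

Local Lemma obey_dem g w0 w y m : chain M c g -> obeys M Phi g w0 -> w0 ≺ w ->
  Dem (between g w0 w) y -> M m -> y m ≼ g w m.
Proof.
move=> gc go ww Dy Mm; have sA := between_small g w0 w.
exact: wle_trans (psup_ub cT (Dem_small sA) (Dem_below sA (between_below gc)) Dy Mm) (go w ww m Mm).
Qed.

Local Lemma al_chain g w0 v w : chain M c g -> obeys M Phi g w0 -> w0 ≼ v -> v ≺ w -> al (g v) ≺ al (g w).
Proof.
move=> gc go wv vw.
have ww : w0 ≺ w := wle_lt_trans wv vw.
have le : al (g v) ≼ al (g w).
  by apply: al_mono => [|m Mm]; [exact: gc.1|exact/wltW/gc.2].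
have [eq|//] := wle_eqVlt le.
have [aa al_a alh] := alP (gc.1 w).
have [m Mm rm] := above_r aa al_a.
have h1 := alh m Mm rm.
have Dv : Dem (between g w0 w) (f (al (g v))) by constructor 1; exists (g v) => //; exists v.
by case: (obey_dem gc go ww Dv Mm); rewrite eq.
Qed.

Let run (g : V -> F) (w0 : V) (x : O) (o : F) : Prop :=
  [/\ chain M c g, obeys M Phi g w0, outcome M g o,
      forall v, w0 ≼ v -> al (g v) ≺ x & forall y, y ≺ x -> exists2 v, w0 ≼ v & y ≺ al (g v)].

Local Lemma exists_run g w0 o : chain M c g -> obeys M Phi g w0 -> outcome M g o ->
  exists x, run g w0 x o.
Proof.
move=> gc go oP; exists (wlub (fun x => exists2 v, w0 ≼ v & al (g v) = x)); split=> //.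
  move=> v wv; have [v' vv] := wsucc_nolast mun sV v.
  apply: wlt_le_trans (al_chain gc go wv vv) _.
  apply: (@wlub_ub _ _ a); last by exists v' => //; exact/wltW/(wle_lt_trans wv).
  by move=> _ [u _ <-]; apply: wltW; have [] := alP (gc.1 u).
by move=> y /wlub_lt[_ [v wv <-] yv]; exists v.
Qed.

Local Lemma run_mono g w0 x o v w : run g w0 x o -> w0 ≼ v -> w0 ≼ w -> al (g v) ≺ al (g w) -> v ≺ w.
Proof.
move=> [gc go _ _ _] wv ww lt; have [//|/wle_eqVlt[wv'|wv']] := wltP v w.
  by move: lt; rewrite wv' => /wlt_irr.
by case: (@wltW _ _ _ lt); exact: (al_chain gc go ww wv').
Qed.

Local Lemma run_le g w0 x o v w : run g w0 x o -> w0 ≼ v -> v ≼ w -> al (g v) ≼ al (g w).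
Proof.
move=> [gc go _ _ _] wv /wle_eqVlt[->|vw]; first exact: wle_refl.
by apply: wltW; exact: (al_chain gc go wv vw).
Qed.

(* Interleaving one run with [mu] runs that have the same limit gives a common [be]. *)
Local Lemma run_meet g w0 x o (G : mu -> V -> F) (W0 : mu -> V) (Os : mu -> F) v :
  run g w0 x o -> (forall m, M m -> run (G m) (W0 m) x (Os m)) -> w0 ≼ v ->
  exists2 t, v ≺ t & forall m, M m -> f (be (between g w0 t)) m ≼ Os m m.
Proof.
move=> rg rG wv.
have [gc go oP gx xg] := rg.
pose Ga u := al (g (wmax w0 u)).
have [u|t [u [vt lim ut uF ux]]] := @omega_limit V (fun u u' => forall m, M m ->
    exists u1, [/\ W0 m ≼ u1, Ga u ≺ al (G m u1) & al (G m u1) ≺ Ga u']) v (wsucc_omega mun sV).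
  have [p pP] : exists p : mu -> V * V, forall m, M m ->
      [/\ W0 m ≼ (p m).1, Ga u ≺ al (G m (p m).1) & al (G m (p m).1) ≺ Ga (p m).2].
    apply: (@fun_choice mu (V * V) (fun m q => M m -> [/\ W0 m ≼ q.1, Ga u ≺ al (G m q.1) & al (G m q.1) ≺ Ga q.2])) => m.
    have [Mm|nM] := pselect (M m); last by exists (u, u).
    have [_ _ _ Gx xG] := rG m Mm.
    have [|u1 Wu1 lt1] := xG (Ga u); first by apply: gx; exact: wmax_l.
    have [u2 wu2 lt2] := xg _ (Gx _ Wu1).
    exists (u1, u2) => _; split=> //=; apply: wlt_le_trans lt2 _.
    by apply: (run_le rg) => //; exact: wmax_r.
  have [w wP] := wsucc_bounded mun sV (fun m => (p m).2) (@cle_refl mu).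
  have [w' w'P] := wsucc_omega mun sV (fun n => if n is 0 then u else w).
  exists w'; first exact: (w'P 0).
  move=> m Mm; have [h1 h2 h3] := pP m Mm; exists (p m).1; split=> //.
  apply: wlt_le_trans h3 _; apply: (run_le rg); first exact: wmax_l.
  apply: wmax_le; first exact: wmax_l.
  by apply: (@wle_trans _ w'); [exact/wltW/(wlt_trans (wP m) (w'P 1))|exact: wmax_r].
exists t => // m Mm.
have [u1 u1P] : exists u1 : nat -> V, forall n,
    [/\ W0 m ≼ u1 n, Ga (u n) ≺ al (G m (u1 n)) & al (G m (u1 n)) ≺ Ga (u n.+1)].
  apply: (@fun_choice nat V (fun n z => [/\ W0 m ≼ z, Ga (u n) ≺ al (G m z) & al (G m z) ≺ Ga (u n.+1)])) => n.
  exact: uF.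
have [w wP] := wsucc_omega mun sV u1.
pose t1 := wlub (fun z => exists n, u1 n = z).
have u1m n : u1 n ≺ u1 n.+1.
  have [h1 h2 h3] := u1P n; have [h4 h5 h6] := u1P n.+1.
  exact: (run_mono (rG m Mm)) h1 h4 (wlt_trans h3 h5).
have u1t n : u1 n ≺ t1.
  apply: wlt_le_trans (u1m n) _; apply: (@wlub_ub _ _ w); last by exists n.+1.
  by move=> _ [k <-]; exact/wltW.
have w0t : w0 ≺ t := wle_lt_trans wv vt.
have [Gc Go Gout Gx xG] := rG m Mm.
have Gau n : exists2 s, w0 ≼ s & s ≺ t /\ Ga (u n) = al (g s).
  by exists (wmax w0 (u n)); [exact: wmax_l|split=> //; exact: wmax_lt].
have <- : be (between (G m) (W0 m) t1) = be (between g w0 t).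
  apply: wle_anti.
    apply: wlub_least => _ [_ [s [Ws st <-]] <-].
    have [_ [n <-] sn] := wlub_lt st; have [h1 h2 h3] := u1P n.
    have [s' ws' [s't gE]] := Gau n.+1.
    have Bs' : between g w0 t (g s') by exists s'.
    apply: (wle_trans _ (be_ub (between_small g w0 t) (between_below gc) Bs')).
    rewrite -gE; apply: wltW; apply: wlt_trans h3; exact: (al_chain Gc Go Ws sn).
  apply: wlub_least => _ [_ [s [ws st <-]] <-].
  have [n sn] := ux _ st; have [h1 h2 h3] := u1P n.
  have Bs' : between (G m) (W0 m) t1 (G m (u1 n)) by exists (u1 n).
  apply: (wle_trans _ (be_ub (between_small (G m) (W0 m) t1) (between_below Gc) Bs')).
  apply: wltW; apply: wle_lt_trans h2; apply: (run_le rg) => //.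
  by apply: (@wle_trans _ (u n)); [exact: wltW|exact: wmax_r].
have Wt1 : W0 m ≺ t1 by have [h _ _] := u1P 0; exact: wle_lt_trans h (u1t 0).
have D2 : Dem (between (G m) (W0 m) t1) (f (be (between (G m) (W0 m) t1))) by constructor 2.
exact: wle_trans (obey_dem Gc Go Wt1 D2 Mm) ((Gout m Mm).1 t1).
Qed.

(** Coordinatewise least value of a supremum among all runs whose positions converge to [x]. It
    depends on [x] alone and serves as the guess for the supremum off a good set. *)
Let lowest (x : O) : F := fun m => wmin (fun y => exists g w0 o, run g w0 x o /\ o m = y).

Local Lemma chain_lt g v w m : chain M c g -> M m -> g v m ≺ g w m -> v ≺ w.
Proof.
move=> gc Mm lt; have [//|h] := wltP v w.
by case: (chain_le gc h Mm).
Qed.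

(** Suppose [lowest x m ≺ o m]. Then [f be1 m ≼ lowest x m ≺ g v m], and either [g v m ≺ f ga m] or
    [f ga m ≼ r m ≺ f a0 m]; in both cases [m] is in [Gs (ga, be1)]. On that set the strategy
    launched at [t] leaves [K] possibilities. So [x], [ga], [be1] and one more index in [K]
    determine [o] wherever [r ≺ f a0]. *)
Local Lemma scale_good_contra : False.
Proof.
have [m0 Mm0] : exists m, M m by have [m] := above_r (@wle_refl _ a0) a0a; exists m.
apply: notgood.
have [H HE] : exists H : K -> F, forall q : (O * (O * (O * K))), exists k, H k =
    (fun m => if pselect (Gs (q.2.1, q.2.2.1) m) then (HP (q.2.1, q.2.2.1)).1 q.2.2.2 m else lowest q.1 m).
  apply: (cle_reindex _ (fun=> wpt O)).
  have sq (X : Type) : cle X K -> cle (O * X) K.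
    by move=> Xm; apply: cle_trans (cle_square Kn); exact: cle_prod.
  by apply/sq/sq/sq/cle_refl.
exists H, Phi; split.
  by move=> A sA Ab; apply: psup_below => //; [exact: Dem_small|exact: Dem_below].
move=> g w0 o gc go oP.
have [x rx] := exists_run gc go oP; have [_ _ _ gx xg] := rx.
have lowP m : lowest x m ≼ o m /\ exists g' w0' o', run g' w0' x o' /\ o' m = lowest x m.
  have [|h1 h2] := @wminP O (fun y => exists g w0 o, run g w0 x o /\ o m = y).
    by exists (o m), g, w0, o.
  by split=> //; apply: h2; exists g, w0, o.
have [G GP] : exists G : mu -> (V -> F) * V * F, forall m, run (G m).1.1 (G m).1.2 x (G m).2 /\ (G m).2 m = lowest x m.
  apply: (@fun_choice mu ((V -> F) * V * F) (fun m q => run q.1.1 q.1.2 x q.2 /\ q.2 m = lowest x m)) => m.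
  by have [_ [g' [w0' [o' h]]]] := lowP m; exists (g', w0', o').
(* A single stage [v] serves all coordinates, since [mu] many points of [V] are bounded. *)
have [v wv vP] : exists2 v, w0 ≼ v & forall m, M m -> lowest x m ≺ o m -> lowest x m ≺ g v m.
  have [e eP] : exists e : mu -> V, forall m, M m -> lowest x m ≺ o m -> lowest x m ≺ g (e m) m.
    apply: (@fun_choice mu V (fun m v => M m -> lowest x m ≺ o m -> lowest x m ≺ g v m)) => m.
    have [[Mm lt]|h] := pselect (M m /\ lowest x m ≺ o m).
      by have [v vP] := (oP m Mm).2 _ lt; exists v.
    by exists w0 => Mm lt; case: h.
  have [v vP] := wsucc_bounded mun sV e (@cle_refl mu).
  exists (wmax w0 v); first exact: wmax_l.
  move=> m Mm lt; apply: wlt_le_trans (eP m Mm lt) _; apply: (chain_le gc) => //.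
  by apply: (@wle_trans _ v); [exact: wltW|exact: wmax_r].
have [t vt tP] := run_meet (G := fun m => (G m).1.1) (W0 := fun m => (G m).1.2) (Os := fun m => (G m).2)
  rx (fun m _ => (GP m).1) wv.
have {}tP m : M m -> f (be (between g w0 t)) m ≼ lowest x m by move=> /tP; rewrite (GP m).2.
have w0t : w0 ≺ t := wle_lt_trans wv vt.
set be1 := be (between g w0 t) in tP.
set ga := al (g v).
have gab : ga ≼ be1.
  by apply: (be_ub (between_small _ _ _) (between_below gc)); exists v.
have okgb : okp (ga, be1).
  split=> //=; first by have [] := alP (gc.1 v).
  exact: be_lt (between_small _ _ _) (between_below gc).
have [|k kP] := (HPP okgb).2 g t o gc _ oP.
  move=> w tw m Mm; have w0w := wlt_trans w0t tw.
  apply: (obey_dem gc go w0w _ Mm); constructor 3.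
  exists (g t), (g v), (g t).
  have ltE : A_lt (g t) (between g w0 w) = between g w0 t.
    apply/funext => h; apply/propext; split=> [[[s [ws sw <-]] lt]|[s [ws st <-]]].
      by exists s; split=> //; exact: chain_lt gc Mm0 (lt m0 Mm0).
    split; first by exists s; split=> //; exact: wlt_trans tw.
    by move=> k Mk; exact: gc.2.
  have geE : A_ge (g t) (between g w0 w) = between g t w.
    apply/funext => h; apply/propext; split=> [[[s [ws sw <-]] le]|[s [ts sw <-]]].
      by exists s; split=> // st; apply: (le m0 Mm0); exact: gc.2.
    split; first by exists s; split=> //; exact: wle_trans (wltW w0t) ts.
    by move=> k Mk; exact: (chain_le gc).
  rewrite ltE geE; split=> //.
  by split; [exists t|exists v|exists t]; split=> //; [exact: wltW|exact: wlt_trans vt tw|exact: wltW].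
have [j jE] := HE (x, (ga, (be1, k))); exists j => m Mm rm; rewrite jE /=.
case: pselect => /= [Gm|nG]; first exact: kP.
have [//|lt] := wle_eqVlt (lowP m).1.
case: nG; have lt1 := vP m Mm lt.
have [h1 h2 h3] := alP (gc.1 v).
have [rg|gr] := wltP (r m) (f ga m).
  by left => /=; apply: wle_lt_trans (tP m Mm) _; apply: wlt_trans lt1 _; exact: h3.
by right => /=; exact: wle_lt_trans gr rm.
Qed.
End Scale.

Lemma scale_good M c K (a : O) (f : O -> F) (r : F) (a0 : O) :
  bigcof M c -> cle O K -> cle nat K -> (forall b, b ≺ a -> below M c (f b)) ->
  (forall b' b, b' ≺ b -> b ≺ a -> good M c K (fun m => f b m ≺ f b' m)) ->
  cofgt V a -> a0 ≺ a ->
  (forall h, below M c h -> exists b,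
    [/\ a0 ≼ b, b ≺ a & forall m, M m -> r m ≺ f b m -> h m ≺ f b m]) ->
  good M c K (fun m => r m ≺ f a0 m).
Proof.
move=> cT OK Kn fb finc acof a0a scale; apply: contrapT => ng.
pose ok p := [/\ a0 ≼ p.1, p.1 ≼ p.2 & p.2 ≺ a].
pose Gs (p : O * O) m := f p.2 m ≺ f p.1 m \/ f p.1 m ≺ f a0 m.
have [HP HPP] : exists HP : O * O -> (K -> F) * ((F -> Prop) -> F), forall p, ok p -> valid M c (HP p).2 /\
  forall g w0 o, chain M c g -> obeys M (HP p).2 g w0 -> outcome M g o ->
    exists k, forall m, M m -> Gs p m -> (HP p).1 k m = o m.
  apply: (@fun_choice (O * O) ((K -> F) * ((F -> Prop) -> F)) (fun p q => ok p -> valid M c q.2 /\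
    forall g w0 o, chain M c g -> obeys M q.2 g w0 -> outcome M g o ->
    exists k, forall m, M m -> Gs p m -> q.1 k m = o m)) => p.
  have [okk|nok] := pselect (ok p); last by exists (fun _ => f a0, fun _ => f a0).
  by have [H [Phi h]] := Gs_good cT Kn finc okk; exists (H, Phi).
exact: (scale_good_contra cT OK Kn fb finc acof a0a scale ng HPP).
Qed.

(** Induction on the length makes the family increase modulo good sets. If [cofgt V a] fails, a
    pointwise supremum of [V] many members works. Otherwise, when no bound exists, [scale_good]
    fails for every candidate [r], and each failure yields a larger function that catches [f b] at
    some coordinate for all late [b]. *)
Theorem good_directed M c K : bigcof M c -> cle O K -> cle nat K -> forall (a : O) (f : O -> F),
  (forall b, b ≺ a -> below M c (f b)) ->
  exists2 h, below M c h & forall b, b ≺ a -> good M c K (fun m => h m ≺ f b m).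
Proof.
move=> cT OK Kn; elim/wind=> a ih f0 f0b.
have [||f fP] := @wrec O F (fun=> wpt O) (fun b f y => b ≺ a -> (forall b', b' ≺ b -> below M c (f b')) ->
   [/\ below M c y, forall m, M m -> f0 b m ≼ y m & forall b', b' ≺ b -> good M c K (fun m => y m ≺ f b' m)]).
- move=> b f f' y ff h ba fb; have [//||h1 h2 h3] := h.
    by move=> b' bb; rewrite ff //; exact: fb.
  by split=> // b' bb; rewrite -ff //; exact: h3.
- move=> b f _; have [[ba fb]|h] := pselect (b ≺ a /\ forall b', b' ≺ b -> below M c (f b')); last first.
    by exists (fun=> wpt O) => ba fb; case: h.
  have [h hb hP] := ih b ba f fb.
  exists (fun m => wmax (f0 b m) (h m)) => _ _; split.
  + by move=> m Mm; apply: wmax_lt; [exact: f0b|exact: hb].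
  + by move=> m _; exact: wmax_l.
  + move=> b' bb; apply: good_sub (hP b' bb) => m _; apply: wle_lt_trans; exact: wmax_r.
have fb : forall b, b ≺ a -> below M c (f b).
  elim/wind=> b ihb ba; have [|//] := fP b ba.
  by move=> b' bb; apply: ihb => //; exact: wlt_trans bb ba.
have {}fP b : b ≺ a -> (forall m, M m -> f0 b m ≼ f b m) /\ forall b', b' ≺ b -> good M c K (fun m => f b m ≺ f b' m).
  by move=> ba; have [|_ ? ?] := fP b ba; first by move=> b' bb; apply: fb; exact: wlt_trans bb ba.
suff [h hb hP] : exists2 h, below M c h & forall b, b ≺ a -> good M c K (fun m => h m ≺ f b m).
  exists h => // b ba; apply: good_sub (hP b ba) => m Mm lt.
  exact: wlt_le_trans lt ((fP b ba).1 m Mm).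
have [[x xa]|none] := pselect (exists x, x ≺ a); last first.
  by exists (fun=> wbot O); [exact: below_bot|move=> b ba; case: none; exists b].
have [acof|nacof] := pselect (cofgt V a); last first.
  have [|e [ea eP]] := not_cofgt _ nacof; first by exists x.
  pose S y := exists w, f (e w) = y.
  have St : Tsmall S by exact: (@TsmallI V (fun w => f (e w))).
  have Sb y : S y -> below M c y by move=> [w <-]; exact: fb.
  exists (psup S); first exact: psup_below.
  move=> b ba; have [w bw] := eP b ba.
  have ub m : M m -> f (e w) m ≼ psup S m by move=> Mm; apply: (psup_ub cT St Sb) Mm; exists w.
  have [->|{}bw] := wle_eqVlt bw.
    by apply: good_empty => // m Mm; exact: ub.
  apply: good_sub ((fP _ (ea w)).2 b bw) => m Mm; exact: wle_lt_trans (ub m Mm).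
apply: contrapT => nob.
have step r : below M c r -> exists p : F * O, [/\ below M c p.1, p.2 ≺ a
    & forall b, p.2 ≼ b -> b ≺ a -> exists m, [/\ M m, r m ≺ f b m & f b m ≼ p.1 m]].
  move=> rb; apply: contrapT => nop; apply: nob; exists r => // a0 a0a.
  apply: (scale_good cT OK Kn fb _ acof a0a) => [b' b bb ba|h hb]; first exact: (fP b ba).2.
  apply: contrapT => nb; apply: nop; exists (h, a0); split=> // b ab ba /=.
  apply: contrapT => nm; apply: nb; exists b; split=> // m Mm rm.
  by apply: contrapT => /= hm; apply: nm; exists m.
pose R (w : V) (G : V -> F * O) (p : F * O) := (forall v, v ≺ w -> below M c (G v).1) ->
  [/\ below M c p.1, p.2 ≺ a & forall b, p.2 ≼ b -> b ≺ a ->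
    exists m, [/\ M m, psup (fun y => exists2 v, v ≺ w & (G v).1 = y) m ≺ f b m & f b m ≼ p.1 m]].
have segT w (G : V -> F * O) : Tsmall (fun y => exists2 v, v ≺ w & (G v).1 = y).
  by apply: (@TsmallI V (fun v => (G v).1)) => // y [v _ <-]; exists v.
have [||G GP] := @wrec V (F * O) (fun=> wpt O, x) R.
- move=> w G G' p GG h b.
  have E : (fun y => exists2 v, v ≺ w & (G v).1 = y) = (fun y => exists2 v, v ≺ w & (G' v).1 = y).
    by apply/funext => y; apply/propext; split=> -[v vw <-]; exists v => //; rewrite GG.
  by rewrite -E; apply: h => v vw; rewrite GG //; exact: b.
- move=> w G _; have [b|nb] := pselect (forall v, v ≺ w -> below M c (G v).1); last first.
    by exists (fun=> wpt O, x).
  have [|p pP] := step (psup (fun y => exists2 v, v ≺ w & (G v).1 = y)); last by exists p.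
  by apply: psup_below => // y [v /b + <-].
have Gb : forall w, below M c (G w).1 by elim/wind=> w ihw; have [] := GP w ihw.
have {}GP w : (G w).2 ≺ a /\ forall b, (G w).2 ≼ b -> b ≺ a ->
    exists m, [/\ M m, forall v, v ≺ w -> (G v).1 m ≺ f b m & f b m ≼ (G w).1 m].
  have [_ h1 h2] := GP w (fun v _ => Gb v); split=> // b Gb' ba.
  have [m [Mm lt le]] := h2 b Gb' ba; exists m; split=> // v vw.
  apply: wle_lt_trans lt; apply: (psup_ub cT (segT _ _)) Mm; last by exists v.
  by move=> y [u _ <-].
have [|b ba bP] := acof.2 (fun w => (G w).2); first by move=> w; exact: (GP w).1.
(* [G w] is the first of the functions to reach [f b] at coordinate [s w], so [s] is an injection of
   [mu^+] into [mu]. *)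
have [s sP] : exists s : V -> mu, forall w, (forall v, v ≺ w -> (G v).1 (s w) ≺ f b (s w)) /\ f b (s w) ≼ (G w).1 (s w).
  apply: (@fun_choice V mu (fun w m => (forall v, v ≺ w -> (G v).1 m ≺ f b m) /\ f b m ≼ (G w).1 m)) => w.
  by have [m [_ ? ?]] := (GP w).2 b (wltW (bP w)) ba; exists m.
apply: sV.2; exists s => v w svw.
have key v' w' : v' ≺ w' -> s v' = s w' -> False.
  by move=> vw ss; have := (sP w').1 _ vw; rewrite -ss; exact: (sP v').2.
by have [//|/key/(_ svw)|/key/(_ (esym svw))] := wlt_total v w.
Qed.
End Good.

(** * Ultraproducts modulo good sets *)

Lemma exists_cofinal_fun (A : Type) (U O : woset) (b : O) : cle nat A -> wsucc A U ->
  cofgt A b -> ~ cofgt U b -> exists E : U -> O,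
    (forall w, E w ≺ b) /\ forall x, x ≺ b -> exists w, forall w', w ≼ w' -> x ≺ E w'.
Proof.
move=> An sU cA nU; have [h [hg hc]] := not_cofgt cA.1 nU.
have ex w : exists x, x ≺ b /\ forall v, v ≼ w -> h v ≺ x.
  have [_ cc] := cofgt_cle (cle_initial_closed An (sU.1 w)) cA.
  have [|x xb xP] := cc (fun v => h (proj1_sig v)); first by move=> v.
  by exists x; split=> // v vw; exact: (xP (exist _ v vw)).
have [E EP] := fun_choice ex; exists E; split=> [w|x /hc[w xw]].
  by have [] := EP w.
by exists w => w' ww; apply: wle_lt_trans xw _; exact: (EP w').2.
Qed.

Section NoHole.
Variables (mu : Type) (V W T O : woset) (K : Type).
Hypotheses (mun : cle nat mu) (sV : wsucc mu V) (sW : wsucc V W) (sT : wsucc W T).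
Hypotheses (OK : cle O K) (Kn : cle nat K).
Local Notation F := (mu -> O).
Variables (M : mu -> Prop) (c : mu -> O).
Hypothesis cT : bigcof T M c.

Local Lemma WT : cle W T. Proof. exact: wsucc_cle sT. Qed.
Local Lemma VT : cle V T. Proof. exact: cle_trans (wsucc_cle sW) WT. Qed.
Local Lemma muT' : cle mu T. Proof. exact: cle_trans (wsucc_cle sV) VT. Qed.
Local Lemma Tn' : cle nat T. Proof. exact: cle_trans mun muT'. Qed.

Local Notation isgood := (good V M c K).

Lemma exists_ultra : ~ isgood M -> exists D : (mu -> Prop) -> Prop,
  [/\ forall A B : mu -> Prop, (forall m, A m -> B m) -> D A -> D B,
      forall A B, D A -> D B -> D (fun m => A m /\ B m),
      forall A, D A \/ D (fun m => ~ A m), forall A, D A -> exists m, A m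
    & forall A, isgood (fun m => ~ A m) -> D A].
Proof.
move=> ng; pose F0 : set_system mu := fun A => isgood (fun m => ~ A m).
have F0P : ProperFilter F0.
  split; first by move=> h; apply: ng; apply: good_sub h => m _ _ [].
  split.
  - by apply: (good_empty V cT Kn) => m _ h; apply: h.
  - move=> A B FA FB; apply: good_sub (good_union Kn FA FB) => m _ nAB.
    have [Am|nA] := pselect (A m); [right=> Bm|by left].
    exact: nAB.
  - by move=> A B AB; apply: good_sub => m _ nB /AB.
have [D [DU FD]] := ultraFilterLemma F0P.
exists D; split.
- by move=> A B AB; apply: filterS.
- by move=> A B; exact: filterI.
- by move=> A; exact: (in_ultra_setVsetC A DU).
- move=> A DA; have [m Am] := @filter_ex _ D _ A DA; by exists m.
- by move=> A; exact: FD.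
Qed.

Variable D : (mu -> Prop) -> Prop.
Hypothesis D_mono : forall A B : mu -> Prop, (forall m, A m -> B m) -> D A -> D B.
Hypothesis D_and : forall A B, D A -> D B -> D (fun m => A m /\ B m).
Hypothesis D_or : forall A, D A \/ D (fun m => ~ A m).
Hypothesis D_ex : forall A, D A -> exists m, A m.
Hypothesis D_good : forall A, isgood (fun m => ~ A m) -> D A.

Local Lemma DM : D M.
Proof. by apply: D_good; apply: (good_empty V cT Kn) => m Mm; apply. Qed.

Local Lemma D_mono2 A B C : D A -> D B -> (forall m, A m -> B m -> C m) -> D C.
Proof. by move=> DA DB h; apply: D_mono (D_and DA DB) => m [Am Bm]; exact: h. Qed.

Local Lemma D_not A : ~ D A -> D (fun m => ~ A m).
Proof. by have [|] := D_or A. Qed.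

Local Lemma D_notle (h h' : F) : ~ D (fun m => h m ≼ h' m) -> D (fun m => h' m ≺ h m).
Proof. by move=> /D_not; apply: D_mono => m /contrapT. Qed.

Lemma ultra_directed (x : O) (f : O -> F) : (forall y, y ≺ x -> below M c (f y)) ->
  exists2 h, below M c h & forall y, y ≺ x -> D (fun m => f y m ≺ h m).
Proof.
move=> fb; have [h hb hP] := good_directed mun sV VT cT OK Kn fb.
have [h' h'b hh'] := below_next mun sV VT cT hb.
exists h' => // y yx; apply: (@D_mono2 M (fun m => f y m ≼ h m)) DM _ _; last first.
  by move=> m Mm le; exact: wle_lt_trans le (hh' m Mm).
by apply: D_good; apply: good_sub (hP y yx) => m _ /contrapT.
Qed.

(** The last clause is pointwise, not modulo [D]: bounds modulo [D] would not pass to the pointwise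
    suprema taken along a guessed ladder. It can be met because the supremum of [T] many functions
    stays below [c]. *)
Lemma exists_scale : exists f : O -> F, [/\ forall x, below M c (f x),
  forall x' x, x' ≺ x -> D (fun m => f x' m ≺ f x m)
  & forall x, (exists n : T -> O, normal_to n x) ->
      exists2 n : T -> O, normal_to n x & forall t m, M m -> f (n t) m ≼ f x m].
Proof.
have [e eP] : exists e : O -> T -> O, forall x, (exists n : T -> O, normal_to n x) -> normal_to (e x) x.
  apply: (@fun_choice O (T -> O) (fun x e => (exists n : T -> O, normal_to n x) -> normal_to e x)) => x.
  have [[n nP]|h] := pselect (exists n : T -> O, normal_to n x); first by exists n.
  by exists (fun=> x).
have [||f fP] := @wrec O F (fun=> wpt O) (fun x f y => (forall x', x' ≺ x -> below M c (f x')) ->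
  [/\ below M c y, forall x', x' ≺ x -> D (fun m => f x' m ≺ y m)
    & normal_to (e x) x -> forall t m, M m -> f (e x t) m ≼ y m]).
- move=> x f f' y ff h fb; have [|h1 h2 h3] := h.
    by move=> x' xx; rewrite ff //; exact: fb.
  split=> // [x' xx|en t m Mm]; first by rewrite -ff //; exact: h2.
  by have [_ el _ _] := en; rewrite -ff //; exact: h3.
- move=> x f _; have [fb|nf] := pselect (forall x', x' ≺ x -> below M c (f x')); last first.
    by exists (fun=> wpt O).
  have [h hb hP] := ultra_directed fb.
  have [en|nen] := pselect (normal_to (e x) x); last by exists h.
  have [_ el _ _] := en.
  pose S y := exists t, f (e x t) = y.
  have St : Tsmall T S by exists (fun t => f (e x t)).
  have Sb y : S y -> below M c y by move=> [t <-]; apply: fb.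
  exists (fun m => wmax (h m) (psup S m)) => _; split.
  + by move=> m Mm; apply: wmax_lt; [exact: hb|exact: (psup_below cT St Sb)].
  + move=> x' xx; apply: D_mono (hP x' xx) => m lt.
    exact: (wlt_le_trans lt (@wmax_l _ _ _)).
  + move=> _ t m Mm; apply: (@wle_trans _ (psup S m)); last exact: wmax_r.
    by apply: (psup_ub cT St Sb) Mm; exists t.
have fb : forall x, below M c (f x) by elim/wind=> x ih; have [] := fP x ih.
exists f; split=> // [x' x|x /eP en].
  by have [_ h _] := fP x (fun x' _ => fb x'); exact: h.
by have [_ _ h] := fP x (fun x' _ => fb x'); exists (e x) => //; exact: h.
Qed.

Variable f : O -> F.
Hypothesis fb : forall x, below M c (f x).
Hypothesis finc : forall x' x, x' ≺ x -> D (fun m => f x' m ≺ f x m).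
Hypothesis fsup : forall x, (exists n : T -> O, normal_to n x) ->
  exists2 n : T -> O, normal_to n x & forall t m, M m -> f (n t) m ≼ f x m.
Variable bt : O.
Hypothesis btT : cofgt T bt.

(* No family of [mu]-sized sets [S m] interleaves with the scale: along a
   guessed club the suprema of initial parts stay bounded, so the values in
   some [S m] would increase [mu^+] times. *)
Lemma not_interleaved (S : mu -> mu -> O) : exists2 x, x ≺ bt & forall y (h : F), y ≺ bt ->
  (forall m, M m -> exists i, h m = S m i) -> D (fun m => f x m ≼ h m) -> ~ D (fun m => h m ≼ f y m).
Proof.
apply: contrapT => nox.
have {nox} [q qP] : exists q : O -> O * F, forall x, x ≺ bt -> [/\ (q x).1 ≺ bt,
    forall m, M m -> exists i, (q x).2 m = S m i, D (fun m => f x m ≼ (q x).2 m)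
    & D (fun m => (q x).2 m ≺ f (q x).1 m)].
  apply: (@fun_choice O (O * F) (fun x p => x ≺ bt -> [/\ p.1 ≺ bt,
    forall m, M m -> exists i, p.2 m = S m i, D (fun m => f x m ≼ p.2 m) & D (fun m => p.2 m ≺ f p.1 m)])) => x.
  have [xb|nx] := pselect (x ≺ bt); last by exists (x, f x).
  apply: contrapT => h; apply: nox; exists x => // y k yb kS xk ky.
  have [y' yy y'b] := cofgt_next Tn' btT yb.
  apply: h; exists (y', k) => _; split=> //=.
  by apply: D_mono2 ky (finc yy) _ => m; exact: wle_lt_trans.
have [Gd [n [Z [GP guess]]]] := club_guessing mun sV sW sT.
pose Q (xi : T -> O) d j : F := psup (fun y => exists z, [/\ Z d z, n d z ≼ j & f (xi (n d z)) = y]).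
(* [Q] uses only the values of [xi] at arguments up to [j], so the recursion can jump past the
   answers for all [d] at once: there are [T] many, and [bt] has larger cofinality. *)
pose sg xi d j := wmin (fun s => s ≺ bt /\ D (fun m => Q xi d j m ≼ f s m)).
pose Gok xi j x := [/\ x ≺ bt, xi j ≺ x & forall d, sg xi d j ≺ bt -> (q (sg xi d j)).1 ≺ x].
pose G xi j := wmin (Gok xi j).
have GE xi xi' j : (forall k, k ≼ j -> xi k = xi' k) -> G xi j = G xi' j.
  move=> xx.
  have QE d : Q xi d j = Q xi' d j.
    congr psup; apply/funext => y; apply/propext.
    by split=> -[z [Zz nj <-]]; exists z; split=> //; rewrite xx.
  have sE d : sg xi d j = sg xi' d j by rewrite /sg QE.
  congr wmin; apply/funext => x; apply/propext; rewrite /Gok xx; last exact: wle_refl.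
  by split=> -[? ? h]; split=> // d; [rewrite -sE|rewrite sE]; exact: h.
have GokG xi j : xi j ≺ bt -> Gok xi j (G xi j).
  move=> xb; have [|//] := @wminP O (Gok xi j).
  have [|x1 x1b x1P] := btT.2 (fun d => if pselect (sg xi d j ≺ bt) then (q (sg xi d j)).1 else xi j).
    by move=> d; case: pselect => //= h; have [] := qP _ h.
  have [x2 xx2 x2b] := cofgt_next Tn' btT xb.
  exists (wmax x1 x2); split; first exact: wmax_lt.
    exact: (wlt_le_trans xx2 (@wmax_r _ _ _)).
  move=> d h; apply: (wlt_le_trans _ (@wmax_l _ _ _)); by have := x1P d; case: pselect.
have [||xi xiE] := @wrec T O (wpt O) (fun i xi y => y = wlub (fun x => exists2 j, j ≺ i & x = G xi j)).
- move=> i xi xi' _ xx ->; congr wlub; apply/funext => x; apply/propext.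
  by split=> -[j ji ->]; exists j => //; [|apply: esym]; apply: GE => k kj; apply: xx; exact: wle_lt_trans kj ji.
- by move=> i xi _; eexists.
have segb i (h : T -> O) : (forall j, j ≺ i -> h j ≺ bt) -> exists2 x, x ≺ bt & forall j, j ≺ i -> h j ≺ x.
  move=> hb; have [[x0 x0b] _] := btT.
  have [|x xb xP] := btT.2 (fun j => if pselect (j ≺ i) then h j else x0).
    by move=> j; case: pselect => //=; exact: hb.
  by exists x => // j ji; have := xP j; case: pselect.
have xib : forall i, xi i ≺ bt.
  elim/wind=> i ih; rewrite xiE.
  have [|x xb xP] := segb i (G xi); first by move=> j /ih /GokG[].
  by apply: wle_lt_trans xb; apply: wlub_least => _ [j ji ->]; exact/wltW/xP.
have xige i j : j ≺ i -> G xi j ≼ xi i.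
  move=> ji; rewrite (xiE i).
  have [|x xb xP] := segb i (G xi); first by move=> k _; have [] := GokG _ _ (xib k).
  by apply: (@wlub_ub _ _ x); [move=> _ [k ki ->]; exact/wltW/xP|exists j].
have xim j i : j ≺ i -> xi j ≺ xi i.
  by move=> ji; apply: wlt_le_trans (xige _ _ ji); have [] := GokG _ _ (xib j).
have [bd bdb bdP] := btT.2 xi xib.
pose de := wlub (fun x => exists i, x = xi i).
have deb : de ≺ bt.
  by apply: wle_lt_trans bdb; apply: wlub_least => _ [i ->]; exact/wltW.
have xide i : xi i ≺ de.
  have [i' ii] := wsucc_nolast (wsucc_nat (wsucc_nat mun sV) sW) sT i.
  apply: wlt_le_trans (xim _ _ ii) _.
  by apply: (@wlub_ub _ _ bd); [move=> _ [k ->]; exact/wltW|exists i'].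
have xin : normal_to xi de.
  split=> //.
  - by move=> y /wlub_lt[_ [i ->] yi]; exists i.
  - move=> t lim y h; rewrite xiE; apply: wlub_least => _ [v vt ->].
    have [r vr rt] := lim _ vt; apply: (wle_trans (xige _ _ vr)); exact: h.
have [n' n'n fn'] := fsup (ex_intro _ xi xin).
have omT := wsucc_omega (wsucc_nat (wsucc_nat mun sV) sW) sT.
(* The pointwise bound [f de] concerns the sequence [n'], not [xi]. Both are normal to [de] and
   agree on a club; on the guessed points of the ladder the bound applies to [xi]. *)
have [d Gdd Zd] := guess _ (club_agree omT xin n'n).
have [nm Zu] := GP d Gdd.
have QT j : Tsmall T (fun y => exists z, [/\ Z d z, n d z ≼ j & f (xi (n d z)) = y]).
  by apply: (@TsmallI mu O T V (fun z => f (xi (n d z)))) => [|y [z [_ _ <-]]]; [exact: VT|exists z].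
have Qb j y : (exists z, [/\ Z d z, n d z ≼ j & f (xi (n d z)) = y]) -> below M c y.
  by move=> [z [_ _ <-]].
have sgP z : Z d z -> sg xi d (n d z) ≺ bt /\ D (fun m => Q xi d (n d z) m ≼ f (sg xi d (n d z)) m).
  move=> Zz; have [|//] := @wminP O (fun s => s ≺ bt /\ D (fun m => Q xi d (n d z) m ≼ f s m)).
  exists de; split=> //; apply: D_mono DM => m Mm.
  by apply: wlub_least => _ [_ [z' [Zz' _ <-]] <-]; rewrite Zd //; exact: fn'.
pose nz z := wmin (fun z' => z ≺ z' /\ Z d z').
have nzP z : [/\ z ≺ nz z, Z d (nz z) & forall z', z ≺ z' -> Z d z' -> nz z ≼ z'].
  have [|[h1 h2] h3] := @wminP V (fun z' => z ≺ z' /\ Z d z').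
    by have [z' ? ?] := Zu z; exists z'.
  by split=> // z' ? ?; exact: h3.
have nle v w : v ≼ w -> n d v ≼ n d w.
  by move=> /wle_eqVlt[->|/nm/wltW //]; exact: wle_refl.
have [s sP] : exists s : V -> mu, forall z, Z d z -> [/\ M (s z),
    Q xi d (n d z) (s z) ≼ (q (sg xi d (n d z))).2 (s z)
    & (q (sg xi d (n d z))).2 (s z) ≺ f (xi (n d (nz z))) (s z)].
  apply: (@fun_choice V mu (fun z m => Z d z -> [/\ M m, Q xi d (n d z) m ≼ (q (sg xi d (n d z))).2 m
    & (q (sg xi d (n d z))).2 m ≺ f (xi (n d (nz z))) m])) => z.
  have [Zz|nZ] := pselect (Z d z); last by have [i0 _] := mun; exists (i0 0).
  have [sb DQ] := sgP z Zz; have [q1 q2 q3 q4] := qP _ sb.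
  have [zn Zn _] := nzP z.
  have lt : (q (sg xi d (n d z))).1 ≺ xi (n d (nz z)).
    have [_ _ /(_ d sb)] := GokG _ _ (xib (n d z)); move/wlt_le_trans; apply.
    by apply: xige; exact: nm.
  have [m [[Mm [h1 h2]] [h3 h4]]] := D_ex (D_and (D_and DM (D_and DQ q3)) (D_and q4 (finc lt))).
  exists m => _; split=> //; first exact: wle_trans h1 h2.
  exact: wlt_trans h3 h4.
have [i iP] : exists i : V -> mu, forall z, Z d z -> (q (sg xi d (n d z))).2 (s z) = S (s z) (i z).
  apply: (@fun_choice V mu (fun z i => Z d z -> (q (sg xi d (n d z))).2 (s z) = S (s z) i)) => z.
  have [Zz|nZ] := pselect (Z d z); last by have [i0 _] := mun; exists (i0 0).
  have [sb _] := sgP z Zz; have [_ q2 _ _] := qP _ sb; have [Ms _ _] := sP z Zz.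
  by have [i iE] := q2 _ Ms; exists i.
(* At a common coordinate, the interleaved value for [z'] is above a scale value that exceeds the
   one for [z]. The pair of [s z] and [i z] therefore determines [z], against the unboundedness of
   [Z d]. *)
have key z z' : Z d z -> Z d z' -> z ≺ z' -> s z = s z' -> i z = i z' -> False.
  move=> Zz Zz' zz ss ii; have [Ms h1 h2] := sP z Zz; have [Ms' h1' _] := sP z' Zz'.
  have [zn Zn nmin] := nzP z.
  have le : f (xi (n d (nz z))) (s z) ≼ Q xi d (n d z') (s z).
    apply: (psup_ub cT (QT _) (@Qb _)) Ms; exists (nz z); split=> //.
    by apply: nle; exact: nmin.
  apply: (@wlt_irr _ (S (s z) (i z))).
  rewrite -{1}iP // ss ii -(iP z') // -ss.
  by apply: wlt_le_trans h2 _; apply: (wle_trans le); rewrite ss.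
have Zmu : cle {z | Z d z} mu.
  apply: cle_trans (cle_square mun).
  exists (fun z => (s (proj1_sig z), i (proj1_sig z))) => -[z Zz] [z' Zz'] /= [ss ii].
  apply: sig_val_inj => /=.
  have [//|zz|zz] := wlt_total z z'; first by case: (key z z').
  by case: (key z' z).
have [w wP] := wsucc_bounded mun sV (fun z : {z | Z d z} => proj1_sig z) Zmu.
have [z wz Zz] := Zu w.
exact: (wltW wz) (wP (exist _ z Zz)).
Qed.

Local Lemma cofgt_bt A : cle A T -> cofgt A bt.
Proof. by move=> AT; exact: cofgt_cle btT. Qed.

(** Otherwise there is a sequence of [mu^+] upper bounds, each chosen below a projection of the
    scale to the values used before. At coordinates [s w] where all relevant inequalities hold, the
    values decrease along each fibre of [s]; so fibres have last elements, which bound [V] by [mu]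
    many points. *)
Lemma exists_ultra_lub : exists g : F, [/\ forall m, M m -> g m ≼ c m,
  forall x, x ≺ bt -> D (fun m => f x m ≺ g m)
  & forall h : F, D (fun m => h m ≺ g m) -> exists2 x, x ≺ bt & D (fun m => h m ≼ f x m)].
Proof.
apply: contrapT => nolub.
pose S (w : V) (u : V -> F) m z := z = c m \/ exists2 v, v ≺ w & u v m = z.
pose pl w u x : F := fun m => wmin (fun z => S w u m z /\ f x m ≼ z).
have plP w u x m : M m -> [/\ S w u m (pl w u x m), f x m ≼ pl w u x m
    & forall z, S w u m z -> f x m ≼ z -> pl w u x m ≼ z].
  move=> Mm; have [|[h1 h2] h3] := @wminP O (fun z => S w u m z /\ f x m ≼ z).
    by exists (c m); split; [left|exact/wltW/fb].
  by split=> // z ? ?; exact: h3.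
pose R w (u : V -> F) (y : F) := exists x, [/\ x ≺ bt, D (fun m => y m ≺ pl w u x m)
  & forall x', x' ≺ bt -> D (fun m => f x' m ≺ y m)].
have [||u uP] := @wrec V F (fun=> wpt O) R.
- move=> w u u' y uu [x [xb yp yf]]; exists x; split=> //.
  have -> // : pl w u' x = pl w u x.
  apply/funext => m; congr wmin; apply/funext => z; apply/propext.
  by split=> -[[->|[v vw <-]] le]; split=> //; (try by left); right; exists v => //; rewrite uu.
- move=> w u _.
  have [e eP] := wsucc_enum sV w.
  have [k kP] := cle_reindex id None (cle_option_nat mun).
  (* The candidate values at a coordinate are [c m] and the earlier [u v m], at most [mu] many. From
     some [x] on, no scale function lies above the projection, so the projection is an upper
     bound. *)
  have [x xb xP] := not_interleaved (fun m i => if k i is Some j then u (e j) m else c m).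
  have plS m : M m -> exists i, pl w u x m = if k i is Some j then u (e j) m else c m.
    move=> Mm; have [[->|[v /eP[j <-] <-]] _ _] := plP w u x m Mm.
      by have [i iE] := kP None; exists i; rewrite iE.
    by have [i iE] := kP (Some j); exists i; rewrite iE.
  have xpl : D (fun m => f x m ≼ pl w u x m).
    by apply: D_mono DM => m Mm; have [] := plP w u x m Mm.
  have plub x' : x' ≺ bt -> D (fun m => f x' m ≺ pl w u x m).
    by move=> x'b; apply: D_notle; exact: xP.
  apply: contrapT => noy; apply: nolub; exists (pl w u x); split=> // [m Mm|h hlt].
    have [_ _ h] := plP w u x m Mm; apply: h; first by left.
    exact/wltW/fb.
  apply: contrapT => nox; apply: noy; exists h; exists x; split=> // x' x'b.
  by apply: D_notle => hle; apply: nox; exists x'.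
have [X XP] : exists X : V -> O, forall w, [/\ X w ≺ bt, D (fun m => u w m ≺ pl w u (X w) m)
    & forall x', x' ≺ bt -> D (fun m => f x' m ≺ u w m)] by exact: fun_choice uP.
have [|x xb xP] := (cofgt_bt VT).2 X; first by move=> w; have [] := XP w.
have [s sP] : exists s : V -> mu, forall w, [/\ M (s w), f x (s w) ≺ u w (s w),
    u w (s w) ≺ pl w u (X w) (s w) & f (X w) (s w) ≺ f x (s w)].
  apply: (@fun_choice V mu (fun w m => [/\ M m, f x m ≺ u w m, u w m ≺ pl w u (X w) m & f (X w) m ≺ f x m])) => w.
  have [_ h1 h2] := XP w.
  by have [m [[? ?] [? ?]]] := D_ex (D_and (D_and DM (h2 x xb)) (D_and h1 (finc (xP w)))); exists m.
have dec w w' : w ≺ w' -> s w = s w' -> u w' (s w) ≺ u w (s w).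
  move=> ww ss; have [_ h1 _ _] := sP w; have [Ms _ h3 h4] := sP w'.
  rewrite ss; apply: wlt_le_trans h3 _; have [_ _ h] := plP w' u (X w') _ Ms.
  apply: h; first by right; exists w.
  by apply: wltW; apply: wlt_trans h4 _; rewrite -ss.
have [mx mxP] : exists mx : mu -> V, forall m w, s w = m -> w ≼ mx m.
  apply: (@fun_choice mu V (fun m v => forall w, s w = m -> w ≼ v)) => m.
  have [[w0 sw0]|none] := pselect (exists w, s w = m); last first.
    by exists (wpt V) => w sw; case: none; exists w.
  have [|_ [w sw <-] wm] := @wlt_min O (fun z => exists2 w, s w = m & u w m = z).
    by exists (u w0 m), w0.
  exists w => w' sw' ww'; apply: (wm (u w' m)); first by exists w'.
  by have := dec _ _ ww'; rewrite sw sw'; apply.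
have [b bP] := wsucc_bounded mun sV mx (@cle_refl mu).
exact: (mxP (s b) b erefl) (bP (s b)).
Qed.

Section Lub.
Variable g : F.
Hypothesis gub : forall x, x ≺ bt -> D (fun m => f x m ≺ g m).
Hypothesis glub : forall h : F, D (fun m => h m ≺ g m) -> exists2 x, x ≺ bt & D (fun m => h m ≼ f x m).

(** Cofinal sets of size [mu] in the [g m] would interleave with the scale, since every function
    below [g] lies below a scale function. *)
Local Lemma lub_cof_mu : D (fun m => cofgt mu (g m)).
Proof.
have [//|nc] := D_or (fun m => cofgt mu (g m)).
have [S SP] : exists S : mu -> mu -> O, forall m, (exists x, x ≺ g m) -> ~ cofgt mu (g m) ->
    (forall i, S m i ≺ g m) /\ forall x, x ≺ g m -> exists i, x ≼ S m i.
  apply: (@fun_choice mu (mu -> O) (fun m S => (exists x, x ≺ g m) -> ~ cofgt mu (g m) ->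
    (forall i, S i ≺ g m) /\ forall x, x ≺ g m -> exists i, x ≼ S i)) => m.
  have [[ex nm]|h] := pselect ((exists x, x ≺ g m) /\ ~ cofgt mu (g m)).
    by have [S hS] := not_cofgt ex nm; exists S.
  by exists (fun=> wpt O) => ex nm; case: h.
have [x xb xP] := not_interleaved S.
have [i0 _] := mun.
have [i iP] : exists i : mu -> mu, forall m, f x m ≺ g m -> ~ cofgt mu (g m) -> f x m ≼ S m (i m).
  apply: (@fun_choice mu mu (fun m i => f x m ≺ g m -> ~ cofgt mu (g m) -> f x m ≼ S m i)) => m.
  have [[lt nm]|h] := pselect (f x m ≺ g m /\ ~ cofgt mu (g m)); last by exists (i0 0) => ? ?; case: h.
  have [|_ h] := SP m _ nm; first by exists (f x m).
  by have [i ?] := h _ lt; exists i.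
have hle : D (fun m => f x m ≼ S m (i m)) by apply: D_mono2 (gub xb) nc iP.
have hlt : D (fun m => S m (i m) ≺ g m).
  apply: D_mono2 (gub xb) nc _ => m lt nm.
  by have [|h _] := SP m _ nm; first by exists (f x m).
have [y yb hy] := glub hlt.
case: (xP y (fun m => S m (i m)) yb) => // m _; by exists (i m).
Qed.

(** Excludes cofinality exactly [U]. With cofinal sequences [E m], one [x] bounds the positions of
    all [E w]; one late [w] satisfies [f x m ≺ E m w] for all relevant [m], against [E w] being
    below [f x] modulo [D]. *)
Local Lemma lub_cof_succ (A : Type) (U : woset) : cle nat A -> cle mu A -> wsucc A U -> cle U T ->
  D (fun m => cofgt A (g m)) -> D (fun m => cofgt U (g m)).
Proof.
move=> An muA sU UT DA; have [//|nc] := D_or (fun m => cofgt U (g m)).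
have [E EP] : exists E : mu -> U -> O, forall m, cofgt A (g m) -> ~ cofgt U (g m) ->
    (forall w, E m w ≺ g m) /\ forall x, x ≺ g m -> exists w, forall w', w ≼ w' -> x ≺ E m w'.
  apply: (@fun_choice mu (U -> O) (fun m E => cofgt A (g m) -> ~ cofgt U (g m) ->
    (forall w, E w ≺ g m) /\ forall x, x ≺ g m -> exists w, forall w', w ≼ w' -> x ≺ E w')) => m.
  have [[cA nU]|h] := pselect (cofgt A (g m) /\ ~ cofgt U (g m)); last first.
    by exists (fun=> wpt O) => ? ?; case: h.
  by have [E EP] := exists_cofinal_fun An sU cA nU; exists E.
have Elt w : D (fun m => E m w ≺ g m).
  by apply: D_mono2 DA nc _ => m cA nU; have [] := EP m cA nU.
have [X XP] : exists X : U -> O, forall w, X w ≺ bt /\ D (fun m => E m w ≼ f (X w) m).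
  apply: (@fun_choice U O (fun w x => x ≺ bt /\ D (fun m => E m w ≼ f x m))) => w.
  by have [x ? ?] := glub (Elt w); exists x.
have [|x xb xP] := (cofgt_bt UT).2 X; first by move=> w; have [] := XP w.
have [e eP] : exists e : mu -> U, forall m, cofgt A (g m) -> ~ cofgt U (g m) -> f x m ≺ g m ->
    forall w', e m ≼ w' -> f x m ≺ E m w'.
  apply: (@fun_choice mu U (fun m w => cofgt A (g m) -> ~ cofgt U (g m) -> f x m ≺ g m ->
    forall w', w ≼ w' -> f x m ≺ E m w')) => m.
  have [[[cA nU] lt]|h] := pselect ((cofgt A (g m) /\ ~ cofgt U (g m)) /\ f x m ≺ g m); last first.
    by exists (wpt U) => ? ? ?; case: h.
  by have [w wP] := (EP m cA nU).2 _ lt; exists w.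
have [w wP] := wsucc_bounded An sU e muA.
have [m [[[cA nU] lt] [h1 h2]]] := D_ex (D_and (D_and (D_and DA nc) (gub xb)) (D_and (XP w).2 (finc (xP w)))).
have h3 := eP m cA nU lt w (wltW (wP m)).
by case: (@wlt_irr _ (f x m)); apply: wlt_trans h3 _; exact: wle_lt_trans h1 h2.
Qed.

Lemma lub_cof : D (fun m => cofgt T (g m)).
Proof.
have Vn := wsucc_nat mun sV; have Wn := wsucc_nat Vn sW.
have muV := wsucc_cle sV; have VW := wsucc_cle sW.
apply: (lub_cof_succ Wn (cle_trans muV VW) sT (@cle_refl _)).
apply: (lub_cof_succ Vn muV sW WT).
apply: (lub_cof_succ mun (@cle_refl _) sV VT).
exact: lub_cof_mu.
Qed.
End Lub.

(** The least upper bound [g] is the new sequence of ordinals. Scale functions are below it only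
    modulo [D] and are replaced by bottom elsewhere. *)
Local Lemma unbounded_family_ultra : exists (M' : mu -> Prop) (c' : mu -> O) (f' : O -> F),
  [/\ bigcof T M' c', forall m, M' m -> M m /\ c' m ≼ c m, forall x, x ≺ bt -> below M' c' (f' x)
    & forall h, below M' c' h -> exists2 x0, x0 ≺ bt & forall x, x0 ≺ x -> x ≺ bt ->
        exists2 m, M' m & h m ≺ f' x m].
Proof.
have [g [gc gub glub]] := exists_ultra_lub.
have gT := lub_cof gub glub.
pose M' m := M m /\ cofgt T (g m).
have DM' : D M' := D_and DM gT.
exists M', g, (fun x m => if pselect (f x m ≺ g m) then f x m else wbot O); split.
- by move=> m [].
- by move=> m [Mm _]; split=> //; exact: gc.
- move=> x _ m [_ [[y yg] _]]; case: pselect => //= _.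
  by apply: wle_lt_trans yg; exact: wbot_le.
- move=> h hb; have [|x0 x0b hx0] := glub h; first exact: D_mono DM'.
  exists x0 => // x xx xb.
  have [m [[M'm h1] [h2 h3]]] := D_ex (D_and (D_and DM' hx0) (D_and (finc xx) (gub x xb))).
  exists m => //; case: pselect => //= _; exact: wle_lt_trans h1 h2.
Qed.
End NoHole.

(* The "no hole" step: every ordinal of large cofinality has an unbounded
   family of that length in a product of ordinals below those of [c]. *)
Theorem unbounded_family (mu : Type) (V W T O : woset) (K : Type) (M : mu -> Prop) (c : mu -> O) :
  cle nat mu -> wsucc mu V -> wsucc V W -> wsucc W T -> cle O K -> cle nat K ->
  bigcof T M c -> ~ good V M c K M -> forall bt : O, cofgt T bt ->
  exists (M' : mu -> Prop) (c' : mu -> O) (f' : O -> mu -> O),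
  [/\ bigcof T M' c', forall m, M' m -> M m /\ c' m ≼ c m, forall x, x ≺ bt -> below M' c' (f' x)
    & forall h, below M' c' h -> exists2 x0, x0 ≺ bt & forall x, x0 ≺ x -> x ≺ bt ->
        exists2 m, M' m & h m ≺ f' x m].
Proof.
move=> mun sV sW sT OK Kn cT ng bt btT.
have [D [D1 D2 D3 D4 D5]] := exists_ultra Kn cT ng.
have [f [fb finc fsup]] := exists_scale mun sV sW sT OK Kn cT D1 D2 D5.
exact: (unbounded_family_ultra mun sV sW sT Kn cT D1 D2 D3 D4 D5 fb finc fsup btT).
Qed.

(** * Dominating families and coverings *)

(** The parameter [A] lets the cofinality requirement descend from [mu^+++] to [mu]. Ordinals of
    cofinality at most [mu] never need domination, because [mu] many points below them are
    cofinal. *)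
Definition dom (mu : Type) (O : woset) (A Q : Type) : Prop := forall b : mu -> O,
  exists G : Q -> mu -> O, forall h : mu -> O, exists k, forall m,
    cofgt A (b m) -> h m ≺ b m -> h m ≼ G k m /\ G k m ≺ b m.

Lemma dom_cle (mu : Type) (O : woset) (A Q Q' : Type) : cle Q Q' -> dom mu O A Q -> dom mu O A Q'.
Proof.
move=> QQ dA b; have [G GP] := dA b.
have [G' G'P] := cle_reindex G (fun=> wpt O) QQ.
by exists G' => h; have [k kP] := GP h; have [k' kE] := G'P k; exists k'; rewrite kE.
Qed.

(** The new coordinates have cofinality exactly [U]. Since [mu] many points of [U] are bounded, one
    index [w] in [U] dominates on all of them simultaneously. *)
Lemma dom_down (mu : Type) (O : woset) (A Q : Type) (U : woset) :
  cle nat A -> cle mu A -> wsucc A U -> cle nat Q -> cle U Q -> dom mu O U Q -> dom mu O A Q.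
Proof.
move=> An muA sU Qn UQ dU b; have [G GP] := dU b.
have [E EP] : exists E : mu -> U -> O, forall m, cofgt A (b m) -> ~ cofgt U (b m) ->
    (forall w, E m w ≺ b m) /\ forall x, x ≺ b m -> exists w, forall w', w ≼ w' -> x ≺ E m w'.
  apply: (@fun_choice mu (U -> O) (fun m E => cofgt A (b m) -> ~ cofgt U (b m) ->
    (forall w, E w ≺ b m) /\ forall x, x ≺ b m -> exists w, forall w', w ≼ w' -> x ≺ E w')) => m.
  have [[cA nU]|h] := pselect (cofgt A (b m) /\ ~ cofgt U (b m)); last first.
    by exists (fun=> wpt O) => ? ?; case: h.
  by have [E EP] := exists_cofinal_fun An sU cA nU; exists E.
have [G' G'P] := cle_reindex (fun (p : Q * U) m => if pselect (cofgt U (b m)) then G p.1 m else E m p.2)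
  (fun=> wpt O) (cle_trans (cle_prod (@cle_refl Q) UQ) (cle_square Qn)).
exists G' => h; have [k kP] := GP h.
have [e eP] : exists e : mu -> U, forall m, cofgt A (b m) -> ~ cofgt U (b m) -> h m ≺ b m ->
    forall w', e m ≼ w' -> h m ≺ E m w'.
  apply: (@fun_choice mu U (fun m w => cofgt A (b m) -> ~ cofgt U (b m) -> h m ≺ b m ->
    forall w', w ≼ w' -> h m ≺ E m w')) => m.
  have [[[cA nU] lt]|nh] := pselect ((cofgt A (b m) /\ ~ cofgt U (b m)) /\ h m ≺ b m); last first.
    by exists (wpt U) => ? ? ?; case: nh.
  by have [w wP] := (EP m cA nU).2 _ lt; exists w.
have [w wP] := wsucc_bounded An sU e muA.
have [j jE] := G'P (k, w); exists j => m cA lt; rewrite jE /=.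
case: pselect => /= [cU|nU]; first exact: kP.
split; last exact: (EP m cA nU).1.
by apply: wltW; apply: (eP m cA nU lt); exact: wltW.
Qed.

(** * Domination when all cofinalities exceed mu^+++ *)

Section BigProducts.
Variables (mu : Type) (V W T O : woset) (K D : Type).
Hypotheses (mun : cle nat mu) (sV : wsucc mu V) (sW : wsucc V W) (sT : wsucc W T).
Hypotheses (OK : cle O K) (Kn : cle nat K) (KD : dd_bound mu K D).
Variable tp : O.
Hypothesis tpP : forall x : O, x ≼ tp.

Local Lemma VT1 : cle V T.
Proof. exact: cle_trans (wsucc_cle sW) (wsucc_cle sT). Qed.

(** Coordinates with value [nu] are good by [good_const]. The others form an increasing union over
    the values [ga ≺ nu] that occur, at most [mu] many, and each piece is good by hypothesis. *)
Lemma good_below (nu : O) (M : mu -> Prop) (c : mu -> O) : bigcof T M c -> (forall m, M m -> c m ≼ nu) ->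
  (forall ga, ga ≺ nu -> forall (M' : mu -> Prop) (c' : mu -> O), bigcof T M' c' -> (forall m, M' m -> c' m ≼ ga) ->
    good V M' c' K M') ->
  good V M c D M.
Proof.
move=> cT cnu small; have KleD := dd_bound_ge mun KD; have Dn := cle_trans Kn KleD.
have g1 : good V M c D (fun m => c m = nu).
  by apply: (good_cle KleD); exact: (good_const mun sV VT1).
suff g2 : good V M c D (fun m => M m /\ c m ≺ nu).
  apply: good_sub (good_union Dn g1 g2) => m Mm _.
  by have [?|?] := wle_eqVlt (cnu m Mm); [left|right].
have [[m0 [Mm0 cm0]]|none] := pselect (exists m, M m /\ c m ≺ nu); last first.
  by apply: (good_empty V cT Dn) => m _ h; case: none; exists m.
pose J0 := {ga : O | exists2 m, M m & c m = ga /\ ga ≺ nu}.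
have j0P : exists2 m, M m & c m = c m0 /\ c m0 ≺ nu by exists m0.
have pi : injective (@proj1_sig _ (fun ga : O => exists2 m, M m & c m = ga /\ ga ≺ nu)).
  by move=> x y; exact: sig_val_inj.
pose J := wpull (exist _ (c m0) j0P : J0) pi.
have Jmu : cle J mu.
  have [e eP] : exists e : J -> mu, forall j, c (e j) = proj1_sig j.
    apply: (@fun_choice J mu (fun j m => c m = proj1_sig j)) => j.
    by case: (proj2_sig j) => m _ [cm _]; exists m.
  by exists e => x y exy; apply: sig_val_inj; rewrite -!eP exy.
pose E (j : J) m := M m /\ c m ≼ proj1_sig j.
have gE j : good V M c K (E j).
  apply: (@good_widen _ _ _ T (E j)) => //; first by move=> m [].
  have jnu : proj1_sig j ≺ nu by case: (proj2_sig j) => m _ [].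
  by apply: (small (proj1_sig j) jnu) => m [Mm le] //; exact: cT.
apply: (good_sub _ (good_chain sV VT1 cT Kn Jmu KD _ gE)).
  move=> m Mm [_ lt]; have jP : exists2 m', M m' & c m' = c m /\ c m ≺ nu by exists m.
  by exists (exist _ (c m) jP : J0); split=> //; exact: wle_refl.
by move=> i j ij m [Mm le]; split=> //; exact: wle_trans le (wltW ij).
Qed.

Theorem dom_big : dom mu O T D.
Proof.
have KleD := dd_bound_ge mun KD.
have fromgood (M : mu -> Prop) (c : mu -> O) : bigcof T M c -> good V M c D M -> exists G : D -> mu -> O,
    forall h, exists k, forall m, M m -> h m ≺ c m -> h m ≼ G k m /\ G k m ≺ c m.
  move=> cT /(good_dom mun sV VT1 cT)[G GP]; exists G => h.
  have [|k kP] := GP (fun m => if pselect (h m ≺ c m) then h m else wbot O).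
    move=> m Mm; case: pselect => //= _; exact: (below_bot cT).
  by exists k => m Mm lt; have := kP m Mm; case: pselect.
have [allgood|bad] := pselect (forall (M : mu -> Prop) (c : mu -> O), bigcof T M c -> good V M c K M).
  move=> b; apply: (fromgood (fun m => cofgt T (b m))) => //.
  by apply: (good_cle KleD); exact: allgood.
pose N nu := exists (M : mu -> Prop) (c : mu -> O), [/\ bigcof T M c, forall m, M m -> c m ≼ nu & ~ good V M c K M].
have [M0 [c0 [cT0 ng0]]] : exists (M : mu -> Prop) (c : mu -> O), bigcof T M c /\ ~ good V M c K M.
  apply: contrapT => h; apply: bad => M c cT; apply: contrapT => ng; apply: h; by exists M, c.
have [|[M1 [c1 [cT1 c1nu ng1]]] numin] := @wminP O N; first by exists tp, M0, c0.
set nu := wmin N in c1nu numin.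
have below_nu (M : mu -> Prop) (c : mu -> O) : bigcof T M c -> (forall m, M m -> c m ≼ nu) -> good V M c D M.
  move=> cT cnu; apply: (good_below cT cnu) => ga gnu M' c' cT' le.
  by apply: contrapT => ng; apply: (numin ga) gnu; exists M', c'.
move=> b.
pose famP m (q : (mu -> Prop) * (mu -> O) * (O -> mu -> O)) := [/\ bigcof T q.1.1 q.1.2,
  forall s, q.1.1 s -> q.1.2 s ≼ nu, forall x, x ≺ b m -> below q.1.1 q.1.2 (q.2 x)
  & forall h, below q.1.1 q.1.2 h -> exists2 x0, x0 ≺ b m & forall x, x0 ≺ x -> x ≺ b m ->
      exists2 s, q.1.1 s & h s ≺ q.2 x s].
have [L LP] : exists L, forall m, cofgt T (b m) -> famP m (L m).
  apply: (@fun_choice mu _ (fun m q => cofgt T (b m) -> famP m q)) => m.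
  have [cb|ncb] := pselect (cofgt T (b m)); last by exists (M1, c1, fun _ => c1).
  have [M' [c' [f' [h1 h2 h3 h4]]]] := unbounded_family mun sV sW sT OK Kn cT1 ng1 cb.
  exists (M', c', f') => _; split=> // s /h2[Ms le].
  exact: wle_trans le (c1nu s Ms).
have [pr prP] : exists pr : mu -> mu * mu, forall p, exists i, pr i = p.
  by have [n _] := mun; apply: cle_reindex id (n 0, n 0) (cle_square mun).
have [io ioP] := fun_choice prP.
(* The [mu] many auxiliary products are merged into one product over [mu], still bounded by [nu],
   hence dominated by [D] functions. *)
pose Mt j := cofgt T (b (pr j).1) /\ (L (pr j).1).1.1 (pr j).2.
pose ct j := (L (pr j).1).1.2 (pr j).2.
have ctT : bigcof T Mt ct by move=> j [/LP[h _ _ _]]; exact: h.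
have [|Gt GtP] := fromgood _ _ ctT.
  by apply: below_nu => // j [/LP[_ h _ _]]; exact: h.
(* A function bounding the [m]-th auxiliary product is turned back into an ordinal: past [x0] the
   unbounded family always escapes it. If [Gt q] dominates the family members at [h], then [h m] is
   not past [x0]. *)
pose okx q m x0 := x0 ≺ b m /\ forall x, x0 ≺ x -> x ≺ b m ->
  exists2 s, (L m).1.1 s & Gt q (io (m, s)) ≺ (L m).2 x s.
exists (fun q m => wmin (okx q m)) => h.
have [q qP] := GtP (fun j => (L (pr j).1).2 (h (pr j).1) (pr j).2).
exists q => m cb hb; have [L1 L2 L3 L4] := LP m cb.
have qs s : (L m).1.1 s -> (L m).2 (h m) s ≼ Gt q (io (m, s)) /\ Gt q (io (m, s)) ≺ (L m).1.2 s.
  move=> Ms; have := qP (io (m, s)); rewrite /Mt /ct ioP /=; apply; first by [].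
  exact: L3.
have [|[x0b x0P] _] := @wminP O (okx q m).
  have [|x0 x0b x0P] := L4 (fun s => Gt q (io (m, s))); first by move=> s /qs[].
  by exists x0.
split=> // lt; have [s Ms lt'] := x0P _ lt hb.
exact: (qs s Ms).1 lt'.
Qed.
End BigProducts.

(* Every element of [x] is reached by finitely many descents from the top. *)
Lemma cov_of_dom (mu : Type) (O : woset) (Q : Type) (tp : O) : cle nat mu -> (forall x : O, x ≼ tp) ->
  dom mu O mu Q -> cov mu O mu (nat -> Q).
Proof.
move=> mun tpP /(fun h => fun_choice h)[Gf GfP].
have [n0 _] := mun.
have [pr prP] : exists pr : mu -> mu * (mu * nat), forall p, exists i, pr i = p.
  apply: cle_reindex id (n0 0, (n0 0, 0)) _.
  have sq (X : Type) : cle X mu -> cle (mu * X) mu.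
    by move=> Xm; apply: cle_trans (cle_square mun); exact: cle_prod (@cle_refl _) Xm.
  by apply/sq/sq.
have [e eP] : exists e : O -> mu -> O, forall x, (exists y, y ≺ x) -> ~ cofgt mu x ->
    (forall i, e x i ≺ x) /\ forall y, y ≺ x -> exists i, y ≼ e x i.
  apply: (@fun_choice O (mu -> O) (fun x e => (exists y, y ≺ x) -> ~ cofgt mu x ->
    (forall i, e i ≺ x) /\ forall y, y ≺ x -> exists i, y ≼ e i)) => x.
  have [[ex nc]|h] := pselect ((exists y, y ≺ x) /\ ~ cofgt mu x); last first.
    by exists (fun=> x) => ? ?; case: h.
  by have [e ?] := not_cofgt ex nc; exists e.
(* Below a point of cofinality above [mu], one ordinal from the [q]-th dominating function is added;
   below any other point that is not the bottom, a cofinal set of size [mu]. *)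
pose step (B : mu -> O) (q : Q) : mu -> O := fun j =>
  if (pr j).2.2 is 0 then Gf B q (pr j).1 else e (B (pr j).1) (pr j).2.1.
pose sB (q : nat -> Q) := fix sB n : mu -> O := if n is n'.+1 then step (sB n') (q n') else fun=> tp.
exists (fun q x => exists n m, sB q n m = x); split=> [q|x].
  apply: cle_trans (cle_trans (cle_prod mun (@cle_refl mu)) (cle_square mun)).
  have ex (y : {x | exists n m, sB q n m = x}) : exists p : nat * mu, sB q p.1 p.2 = proj1_sig y.
    by case: y => y [n [m nm]]; exists (n, m).
  have [p pP] := fun_choice ex; exists p => y z yz; apply: sig_val_inj.
  by rewrite -!pP yz.
have [kk kkP] : exists kk : (mu -> O) -> Q, forall B m, cofgt mu (B m) -> forall i, x i ≺ B m ->
    x i ≼ Gf B (kk B) m /\ Gf B (kk B) m ≺ B m.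
  apply: (@fun_choice (mu -> O) Q (fun B k => forall m, cofgt mu (B m) -> forall i, x i ≺ B m ->
    x i ≼ Gf B k m /\ Gf B k m ≺ B m)) => B.
  pose h m := wlub (fun y => exists2 i, x i = y & x i ≺ B m).
  have hP m : cofgt mu (B m) -> (forall i, x i ≺ B m -> x i ≼ h m) /\ h m ≺ B m.
    move=> [[y0 y0B] cB]; have [|y yB yP] := cB (fun i => if pselect (x i ≺ B m) then x i else y0).
      by move=> i; case: pselect.
    have ub z : (exists2 i, x i = z & x i ≺ B m) -> z ≼ y.
      by move=> [i <- lt]; have := yP i; case: pselect => //= _; exact: wltW.
    split=> [i lt|]; first by apply: (wlub_ub ub); exists i.
    exact: wle_lt_trans (wlub_least ub) yB.
  have [k kP] := GfP B h; exists k => m cB i lt; have [h1 h2] := hP m cB.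
  have [h3 h4] := kP m cB h2; split=> //; exact: wle_trans (h1 i lt) h3.
pose Bs n := iter n (fun B => step B (kk B)) (fun=> tp).
exists (fun n => kk (Bs n)) => i.
have sBE n : sB (fun n => kk (Bs n)) n = Bs n by elim: n => [//|n ih] /=; rewrite ih.
suff [n [m nm]] : exists n m, Bs n m = x i by exists n, m; rewrite sBE.
(* The least generated ordinal above [x i] must equal [x i], since otherwise the next step generates
   a smaller one that is still above [x i]. *)
have [|[[n [m nm]] xle] ymin] := @wminP O (fun y => (exists n m, Bs n m = y) /\ x i ≼ y).
  by exists tp; split=> //; exists 0, (n0 0).
set y := wmin _ in nm xle ymin.
have [xy|lt] := wle_eqVlt xle; first by exists n, m; rewrite nm.
exfalso; suff [y' [[m' m'E] xy' yy']] : exists y', [/\ exists m', Bs n.+1 m' = y', x i ≼ y' & y' ≺ y].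
  by apply: (ymin y') yy'; split=> //; exists n.+1, m'.
rewrite -nm in lt *.
have [cB|nB] := pselect (cofgt mu (Bs n m)).
  have [h1 h2] := kkP _ _ cB i lt; have [j jE] := prP (m, (m, 0)).
  by exists (Gf (Bs n) (kk (Bs n)) m); split=> //; exists j; rewrite /= /step jE.
have [|h1 h2] := eP (Bs n m) _ nB; first by exists (x i).
have [i' le] := h2 _ lt; have [j jE] := prP (m, (i', 1)).
by exists (e (Bs n m) i'); split=> //; exists j; rewrite /= /step jE.
Qed.

Lemma cov_cle (mu A tau Q Q' : Type) : cle Q Q' -> cov mu A tau Q -> cov mu A tau Q'.
Proof.
move=> [f fi] [P [Pt Pc]]; exists (fun q' a => exists2 q, f q = q' & P q a); split=> [q'|x].
  have [[q qq]|none] := pselect (exists q, f q = q').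
    apply: cle_trans (Pt q).
    have h (a : {a | exists2 q, f q = q' & P q a}) : P q (proj1_sig a).
      by case: a => a [q1 + Pa] /=; rewrite -qq => /fi <-.
    by exists (fun a => exist (P q) _ (h a)) => a b [] /sig_val_inj.
  have h (a : {a | exists2 q, f q = q' & P q a}) : False.
    by case: a => a [q1 qq _]; apply: none; exists q1.
  by exists (fun a => False_rect _ (h a)) => a; case: (h a).
by have [q qP] := Pc x; exists (f q) => i; exists q.
Qed.

Lemma cov_sub (mu A A' tau Q : Type) : cle A' A -> cov mu A tau Q -> cov mu A' tau Q.
Proof.
move=> [f fi] [P [Pt Pc]]; exists (fun q a => P q (f a)); split=> [q|x].
  apply: cle_trans (Pt q).
  by exists (fun a : {a | P q (f a)} => exist (P q) _ (proj2_sig a)) => a b [] /fi /sig_val_inj.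
by have [q qP] := Pc (fun i => f (x i)); exists q.
Qed.

(** * Iterating [ded] *)

Lemma ded_mono K K' : cle K K' -> cle (ded K) (ded K').
Proof.
move=> /cle_le_cardinal KK; apply/cle_le_cardinal; apply: (dedP K).2 => d I [A Ad AK].
by apply: (dedP K').1; exists A => //; exact: card_le_trans AK KK.
Qed.

Lemma cov_first_dd (mu D1 D2 D3 D4 : Type) : cle nat mu ->
  dd_bound mu mu D1 -> dd_bound mu D1 D2 -> dd_bound mu D2 D3 -> dd_bound mu D3 D4 ->
  ~ cle (mu -> bool) D4 -> cov mu D1 mu D4.
Proof.
move=> mun d1 d2 d3 d4 npow.
have l1 := dd_bound_ge mun d1; have l2 := dd_bound_ge mun d2.
have l3 := dd_bound_ge mun d3; have l4 := dd_bound_ge mun d4.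
have m2 := cle_trans l1 l2; have m3 := cle_trans m2 l3.
(* While [2^mu] does not fit into [K], some tree on [K] has more than [K] branches. *)
have strict K D : cle mu K -> cle K D4 -> dd_bound mu K D -> ~ cle D K.
  move=> muK KD4 dK DK; have [|B [U [x [xT nB]]]] := exists_pow_system mun muK.
    by move=> h; apply: npow; exact: cle_trans KD4.
  by apply: nB; exact: cle_trans (dK _ _ _ xT) DK.
have s1 := strict _ _ (@cle_refl mu) (cle_trans l1 (cle_trans l2 (cle_trans l3 l4))) d1.
have s2 := strict _ _ l1 (cle_trans l2 (cle_trans l3 l4)) d2.
have s3 := strict _ _ m2 (cle_trans l3 l4) d3.
have [V sV] := exists_wsucc mu; have [W sW] := exists_wsucc V; have [T sT] := exists_wsucc W.
have Vn := wsucc_nat mun sV; have Wn := wsucc_nat Vn sW.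
have VD : cle V D1 := wsucc_least sV s1.
have WD : cle W D2 by apply: (wsucc_least sW) => h; apply: s2; exact: cle_trans VD.
have TD : cle T D3 by apply: (wsucc_least sT) => h; apply: s3; exact: cle_trans WD.
have D1n := cle_trans mun l1; have D3n := cle_trans mun m3.
have [k _] := D1n; have [W0 WE] := exists_woset (k 0); pose O := wtop W0.
have OD : cle O D1 by rewrite -WE in D1n *; exact: cle_option_nat.
(* [D2] functions suffice here; passing to [D3] makes room for the cofinal sequences of length up to
   [mu^+++] in the descent below. *)
have domT := dom_cle l3 (dom_big mun sV sW sT OD D1n d2 (@wtop_le W0)).
have muV := wsucc_cle sV; have VW := wsucc_cle sW.
have domW := dom_down Wn (cle_trans muV VW) sT D3n TD domT.
have domV := dom_down Vn muV sW D3n (cle_trans WD l3) domW.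
have domM := dom_down mun (@cle_refl mu) sV D3n (cle_trans VD (cle_trans l2 l3)) domV.
have cO := cov_cle (cle_pow_nat mun D3n d4) (cov_of_dom mun (@wtop_le W0) domM).
by rewrite -WE; apply: cov_sub cO; exists Some => x y [].
Qed.

Theorem pow2_le_dd (mu D1 D2 D3 D4 : Type) : cle nat mu ->
  dd_bound mu mu D1 -> dd_bound mu D1 D2 -> dd_bound mu D2 D3 -> dd_bound mu D3 D4 ->
  (forall D, dd_bound mu D1 D -> cle D2 D) -> (forall D, dd_bound mu D2 D -> cle D3 D) ->
  (forall D, dd_bound mu D3 D -> cle D4 D) -> cle (mu -> bool) D4.
Proof.
move=> mun d1 d2 d3 d4 min2 min3 min4; apply: contrapT => npow.
have l1 := dd_bound_ge mun d1; have l2 := dd_bound_ge mun d2.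
have l3 := dd_bound_ge mun d3; have l4 := dd_bound_ge mun d4.
have m2 := cle_trans l1 l2; have m3 := cle_trans m2 l3; have m4 := cle_trans m3 l4.
have c1 := cov_first_dd mun d1 d2 d3 d4 npow.
(* Universe and size of the covering sets climb together, from [D1] and [mu] to [D4] and [D3], while
   the number of sets stays [D4]. The climb stops where [dd] of the size is still at most [D4]. *)
have c2 := cov_dd mun l1 (@cle_refl mu) (cle_trans l3 l4) d2 min2 d1 c1.
have c3 := cov_dd mun m2 l1 l4 d3 min3 d2 c2.
have c4 := cov_dd mun m3 m2 (@cle_refl D4) d4 min4 d3 c3.
by apply: npow; exact: cov_pow mun m4 c4 d4.
Qed.

Theorem pow2_le_ded4 (mu : Type) : cle nat mu -> cle (mu -> bool) (ded (ded (ded (ded mu)))).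
Proof.
move=> mun.
have [D1 [d1 _ e1]] := exists_dd mun (@cle_refl mu); have l1 := dd_bound_ge mun d1.
have [D2 [d2 min2 e2]] := exists_dd mun l1; have l2 := cle_trans l1 (dd_bound_ge mun d2).
have [D3 [d3 min3 e3]] := exists_dd mun l2; have l3 := cle_trans l2 (dd_bound_ge mun d3).
have [D4 [d4 min4 e4]] := exists_dd mun l3.
apply: cle_trans (pow2_le_dd mun d1 d2 d3 d4 min2 min3 min4) _.
apply: cle_trans e4 (ded_mono _); apply: cle_trans e3 (ded_mono _).
exact: cle_trans e2 (ded_mono e1).
Qed.

Lemma cle_ded K : cle nat K -> cle K (ded K).
Proof. by move=> Kn; apply: dd_bound_ge Kn (dd_bound_ded Kn (@cle_refl K)). Qed.

Lemma infinite_cardinalP K : infinite_cardinal K <-> cle nat K.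
Proof. by rewrite /infinite_cardinal infiniteP; split=> /cle_le_cardinal. Qed.

Theorem theorem2p10 (mu : cardinal) (mu_inf : infinite_cardinal mu) :
  (exists l0 l1 l2 l3 l4 : cardinal,
     (infinite_cardinal l0 /\ infinite_cardinal l1 /\ infinite_cardinal l2 /\
      infinite_cardinal l3 /\ infinite_cardinal l4) /\
     le_cardinal l0 mu /\
     le_cardinal l1 (ded l0) /\
     le_cardinal l2 (ded l1) /\
     le_cardinal l3 (ded l2) /\
     le_cardinal l4 (ded l3) /\
     le_cardinal (pow2 mu) l4) /\
  le_cardinal (pow2 mu) (ded (ded (ded (ded mu)))).
Proof.
have mun := (infinite_cardinalP mu).1 mu_inf.
have pow := (cle_le_cardinal _ _).1 (pow2_le_ded4 mun).
have inf1 := cle_trans mun (cle_ded mun); have inf2 := cle_trans inf1 (cle_ded inf1).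
have inf3 := cle_trans inf2 (cle_ded inf2); have inf4 := cle_trans inf3 (cle_ded inf3).
have refl K : le_cardinal K K by apply/cle_le_cardinal; exact: cle_refl.
split=> //; exists mu, (ded mu), (ded (ded mu)), (ded (ded (ded mu))), (ded (ded (ded (ded mu)))).
by do !split=> //; exact/infinite_cardinalP.
Qed.
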